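(* Let $v$ be a typical and essential weight for which there exists $k\in\mathbb{N}$ such that $$\limsup_{n \to \infty}\dfrac{v(1-2^{-n-k})}{v(1-2^{-n})} < 1 \quad\text{and}\quad \sup_{n \in \mathbb{N}}\dfrac{v(1-2^{-n})}{v(1-2^{-n-1})} < +\infty,$$ and let $\hat{v}(z) = (1-|z|)v(z)$, $z \in \mathbb{D}$. Let $\Omega \subset \mathbb{C}$ be a hyperbolic domain with universal covering map $f_{\Omega}\colon\mathbb{D}\to\Omega$. Assume that $0 \in \Omega$. The following facts are equivalent: (a) $\mathrm{Hol}(\mathbb{D},\Omega) \subset \mathcal{B}_{\hat{v}}$; (b) $f_{\Omega} \in \mathcal{B}_{\hat{v}}$; (c) $\displaystyle\sup_{w \in \Omega}|w|\,v\left(\dfrac{e^{d_{\Omega}(0,w)}-1}{e^{d_{\Omega}(0,w)}+1}\right) < +\infty$.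
   Context: $\mathbb{D}$ is the open unit disk and $\mathrm{Hol}(\mathbb{D},\Omega)$ is the set of holomorphic maps on $\mathbb{D}$ with values in $\Omega$. A domain is an open connected subset of $\mathbb{C}$; it is hyperbolic if $\mathbb{C}\setminus\Omega$ contains at least two points, in which case there is a holomorphic universal covering map $f_\Omega\colon\mathbb{D}\to\Omega$. A weight $v\colon\mathbb{D}\to[0,+\infty)$ is typical if $v(z)>0$ for all $z$, $v$ is radial ($v(z)=v(|z|)$), $v$ is continuous and non-increasing with respect to $|z|$, and $\lim_{|z|\to1^-}v(z)=0$. $\mathrm{H}^\infty_v$ is the space of holomorphic $f\colon\mathbb{D}\to\mathbb{C}$ with $\sup_{z\in\mathbb{D}}|f(z)|v(z)<+\infty$. The associated weight is $\widetilde v(z)=\inf\{1/|f(z)| : f\in\mathrm{H}^\infty_v,\ |f(\zeta)|v(\zeta)\le1\ \text{for all }\zeta\in\mathbb{D}\}$ (with $1/0=+\infty$). The weight $v$ is essential if there exists $C>0$ with $\widetilde v(z)\le Cv(z)$ for all $z\in\mathbb{D}$. For a weight $u$, the Bloch-type space $\mathcal{B}_u$ is the set of holomorphic $f\colon\mathbb{D}\to\mathbb{C}$ with $\sup_{z\in\mathbb{D}}|f'(z)|u(z)<+\infty$. Hyperbolic distance: for $z_1,z_2\in\mathbb{D}$, $d_{\mathbb{D}}(z_1,z_2)=\log\frac{1+\rho}{1-\rho}$ with $\rho=\left|\frac{z_1-z_2}{1-z_1\overline{z_2}}\right|$. For a hyperbolic domain $\Omega$ and $w_1,w_2\in\Omega$,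 $d_\Omega(w_1,w_2)=\inf\{d_{\mathbb{D}}(a,b): a,b\in\mathbb{D},\ f_\Omega(a)=w_1,\ f_\Omega(b)=w_2\}$ (independent of the choice of $f_\Omega$). *)

(* Defs.v *)
From Stdlib Require Import Reals.
From Coquelicot Require Import Coquelicot.
Open Scope R_scope.

Definition unit_disc (z : C) : Prop := Cmod z < 1.

Definition connected_set (A : C -> Prop) : Prop :=
  forall U V : C -> Prop, open U -> open V ->
    (forall z, A z -> U z \/ V z) ->
    (exists z, A z /\ U z) -> (exists z, A z /\ V z) ->
    exists z, A z /\ U z /\ V z.

Definition domain (Omega : C -> Prop) : Prop :=
  open Omega /\ connected_set Omega.

Definition hyperbolic_domain (Omega : C -> Prop) : Prop :=
  domain Omega /\ exists a b : C, a <> b /\ ~ Omega a /\ ~ Omega b.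

(* Maps defined on a subset [A] of [C] are represented by total functions whose
   values off [A] are never used; as [A] is always open here, differentiability
   and continuity at the points of [A] do not depend on those values. *)
Definition holomorphic_on (A : C -> Prop) (f : C -> C) : Prop :=
  forall z : C, A z -> ex_derive f z.

Definition Hol (A Omega : C -> Prop) (f : C -> C) : Prop :=
  holomorphic_on A f /\ forall z : C, A z -> Omega (f z).

Definition homeomorphism_on (A B : C -> Prop) (p : C -> C) : Prop :=
  exists s : C -> C,
    (forall z, A z -> B (p z) /\ continuous p z /\ s (p z) = z) /\
    (forall w, B w -> A (s w) /\ continuous s w /\ p (s w) = w).

Definition evenly_covered (X U : C -> Prop) (p : C -> C) : Prop :=
  exists (I : Type) (V : I -> C -> Prop),
    (forall i, open (V i)) /\
    (forall i j z, V i z -> V j z -> i = j) /\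
    (forall z, X z /\ U (p z) <-> exists i, V i z) /\
    (forall i, homeomorphism_on (V i) U p).

(* For open [X] and [Y]. *)
Definition covering_map (X Y : C -> Prop) (p : C -> C) : Prop :=
  (forall z, X z -> Y (p z) /\ continuous p z) /\
  (forall w, Y w -> exists z, X z /\ p z = w) /\
  (forall w, Y w -> exists U : C -> Prop,
     open U /\ U w /\ (forall u, U u -> Y u) /\ evenly_covered X U p).

(* A covering is universal when its total space is simply connected, which is
   the case of the disc: every covering map from the disc is universal. *)
Definition holomorphic_universal_covering (Omega : C -> Prop) (f : C -> C) :
    Prop :=
  Hol unit_disc Omega f /\ covering_map unit_disc Omega f.

(* The supremum of [g] over [A] is less than [+oo]. *)
Definition finite_sup (A : C -> Prop) (g : C -> R) : Prop :=
  bound (fun y : R => exists z : C, A z /\ y = g z).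

Definition typical_weight (v : C -> R) : Prop :=
  (forall z, unit_disc z -> 0 < v z) /\
  (forall z, unit_disc z -> v z = v (RtoC (Cmod z))) /\
  (forall z, unit_disc z -> continuous v z) /\
  (forall z1 z2, unit_disc z1 -> unit_disc z2 -> Cmod z1 <= Cmod z2 ->
     v z2 <= v z1) /\
  filterlim (fun r : R => v (RtoC r)) (at_left 1) (locally 0).

Definition Hinf (v : C -> R) (f : C -> C) : Prop :=
  holomorphic_on unit_disc f /\
  finite_sup unit_disc (fun z => Cmod (f z) * v z).

(* [1 / x] for [x >= 0], with [1 / 0 = +oo] (whereas [Rbar_inv 0 = 0]). *)
Definition inv_ext (x : R) : Rbar :=
  if Req_EM_T x 0 then p_infty else Finite (/ x).

Definition associated_weight (v : C -> R) (z : C) : Rbar :=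
  Rbar_glb (fun y : Rbar => exists f : C -> C,
    Hinf v f /\
    (forall zeta, unit_disc zeta -> Cmod (f zeta) * v zeta <= 1) /\
    y = inv_ext (Cmod (f z))).

Definition essential_weight (v : C -> R) : Prop :=
  exists c : R, 0 < c /\
    forall z, unit_disc z -> Rbar_le (associated_weight v z) (Finite (c * v z)).

Definition Bloch (u : C -> R) (f : C -> C) : Prop :=
  holomorphic_on unit_disc f /\
  finite_sup unit_disc (fun z => Cmod (C_derive f z) * u z).

Definition hat_weight (v : C -> R) (z : C) : R := (1 - Cmod z) * v z.

Definition disc_dist (z1 z2 : C) : R :=
  let rho := Cmod ((z1 - z2) / (1 - z1 * Cconj z2))%C in
  ln ((1 + rho) / (1 - rho)).

(* The hyperbolic distance of [Omega] computed from a universal covering map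
   [f] of [Omega]; for [w1], [w2] in [Omega] the infimum is that of a non-empty
   set of non-negative reals, hence a real number. *)
Definition hyp_dist (f : C -> C) (w1 w2 : C) : R :=
  real (Glb_Rbar (fun d : R => exists a b : C,
    unit_disc a /\ unit_disc b /\ f a = w1 /\ f b = w2 /\ d = disc_dist a b)).

(* Main.v *)
(* A holomorphic f lies in the Bloch space of (1-|z|) v if and only if |f| v is
   bounded: the limsup condition makes v decay geometrically along dyadic radii,
   so integrating f' loses nothing, while the doubling condition lets v pass
   through Cauchy's estimate for f'.  A holomorphic g from the disc to Omega
   lifts to g = f_Omega o phi, and by Schwarz-Pick 1-|phi(z)| is at least a
   constant, depending only on phi(0), times 1-|z|; doubling then gives
   |g| v <= K sup |f_Omega| v.  This yields (b) => (a), and, applied to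
   f_Omega o mu for Moebius maps mu with f_Omega(mu(0)) = 0, with lifts sending 0
   to one fixed zero of f_Omega, it yields (b) => (c) uniformly in the zero used
   to compute d_Omega(0,w), without deck transformations.  For (c) => (b),
   compare d_Omega(0, f_Omega(z)) with the distance from z to a fixed zero.

   The lift is holomorphic because a covering map has no critical point.
   Everything rests on the maximum principle, which comes from Goursat's
   bisection argument carried out in polar coordinates. *)
Require Import Defs.
From Stdlib Require Import Reals Arith Psatz ClassicalEpsilon IndefiniteDescription.
From Coquelicot Require Import Coquelicot.
Open Scope R_scope.

(** * Complex derivatives *)

(** Holomorphy is differentiability at each point, with no continuity of the derivative. A
    difference quotient is therefore known to be only continuous at its centre, and the maximum
    principle is put in a form that tolerates one such point. In that form it yields Schwarz's
    lemma, Cauchy's estimate and the non-vanishing derivative of an injective map. Polar coordinates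
    turn an annulus into a rectangle, so that Goursat's argument compares two circles directly, with
    no contour to deform.

    The infimum in [hyp_dist] runs over preimages of both points and is not shown to be attained.
    For (c) => (b) one pair of preimages is enough: a smaller distance only enlarges the weight,
    which is non-increasing. For (b) => (c) the bound is proved for pairs that nearly realize the
    infimum, and continuity of [v] carries it to the infimum itself. *)

Lemma Cmod_triang_inv (x y : C) : Rabs (Cmod x - Cmod y) <= Cmod (x - y).
Proof.
  pose proof (Cmod_triangle y (x - y)) as H1.
  pose proof (Cmod_triangle x (- (x - y))) as H2. rewrite Cmod_opp in H2.
  replace (y + (x - y))%C with x in H1 by ring.
  replace (x + - (x - y))%C with y in H2 by ring.
  apply Rabs_le; lra.
Qed.

Lemma Cmod_minus_sym (x y : C) : Cmod (x - y) = Cmod (y - x).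
Proof. rewrite <- (Cmod_opp (x - y)). f_equal; ring. Qed.

Lemma Cmod_minus_triangle (x y z : C) : Cmod (x - z) <= Cmod (x - y) + Cmod (y - z).
Proof. replace (x - z)%C with ((x - y) + (y - z))%C by ring. apply Cmod_triangle. Qed.

Lemma Cmod_sqr (z : C) : Cmod z * Cmod z = Re z * Re z + Im z * Im z.
Proof.
  unfold Cmod, Re, Im. rewrite sqrt_sqrt; [ring|nra].
Qed.

Lemma Cmod_pair_le (x y : R) : Cmod (x, y) <= Rabs x + Rabs y.
Proof.
  replace ((x, y) : C) with (RtoC x + Ci * RtoC y)%C
    by (apply injective_projections; simpl; ring).
  eapply Rle_trans; [apply Cmod_triangle|].
  rewrite Cmod_mult, Cmod_Ci, !Cmod_R. lra.
Qed.

Lemma Re_le_Cmod (z : C) : Re z <= Cmod z.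
Proof. pose proof (re_le_Cmod z). pose proof (Rle_abs (Re z)). lra. Qed.

Lemma Rabs_Re_Im_le_Cmod (z : C) : Rabs (Re z) <= Cmod z /\ Rabs (Im z) <= Cmod z.
Proof.
  pose proof (Rmax_Cmod z). unfold Re, Im.
  pose proof (Rmax_l (Rabs (fst z)) (Rabs (snd z))).
  pose proof (Rmax_r (Rabs (fst z)) (Rabs (snd z))). lra.
Qed.

(** Turns a modulus into the real part of a linear expression, to which real-variable arguments
    apply. *)
Lemma unimodular_rotation (z : C) :
  exists u : C, Cmod u = 1 /\ (u * z)%C = RtoC (Cmod z).
Proof.
  destruct (Ceq_dec z (RtoC 0)) as [->|Hz].
  - exists (RtoC 1). rewrite Cmod_1, Cmod_0. split; [reflexivity|ring].
  - exists (Cconj z / RtoC (Cmod z))%C.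
    assert (Hm : 0 < Cmod z) by (apply Cmod_gt_0; exact Hz).
    assert (Hc : RtoC (Cmod z) <> RtoC 0) by (intros E; apply RtoC_inj in E; lra).
    split.
    + rewrite Cmod_div by exact Hc.
      rewrite Cmod_conj, Cmod_R, Rabs_pos_eq by lra. field; lra.
    + replace (RtoC (Cmod z)) with (RtoC (Cmod z * Cmod z) / RtoC (Cmod z))%C at 2
        by (rewrite RtoC_mult; field; exact Hc).
      rewrite Cmod_sqr. unfold Cdiv.
      replace (RtoC (Re z * Re z + Im z * Im z)) with (Cconj z * z)%C; [ring|].
      apply injective_projections; unfold Re, Im; simpl; ring.
Qed.

(** The uniform structure of [C] used by [continuous] is that of a product, whose balls are squares;
    comparing them with [Cmod] discs costs the factor [sqrt 2]. *)
Lemma continuous_C_eps (f : C -> C) (z : C) :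
  continuous f z <->
  forall eps, 0 < eps -> exists delta, 0 < delta /\
    forall w, Cmod (w - z) < delta -> Cmod (f w - f z) < eps.
Proof.
  split.
  - intros H eps He.
    assert (H2 : 0 < sqrt 2) by (apply sqrt_lt_R0; lra).
    assert (He' : 0 < eps / sqrt 2) by (apply Rdiv_lt_0_compat; lra).
    destruct (proj1 (filterlim_locally f (f z)) H (mkposreal _ He')) as [d Hd].
    exists d; split; [apply cond_pos|]. intros w Hw.
    specialize (Hd w (C_NormedModule_mixin_compat1 _ _ _ Hw)).
    pose proof (C_NormedModule_mixin_compat2 _ _ _ Hd) as E.
    simpl in E. replace eps with (sqrt 2 * (eps / sqrt 2)) by (field; lra). exact E.
  - intros H. apply filterlim_locally. intros eps.
    destruct (H eps (cond_pos eps)) as [d [Hd Hw]].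
    assert (H2 : 0 < sqrt 2) by (apply sqrt_lt_R0; lra).
    assert (He' : 0 < d / sqrt 2) by (apply Rdiv_lt_0_compat; lra).
    exists (mkposreal _ He'). intros w Hb.
    apply C_NormedModule_mixin_compat1. apply Hw.
    pose proof (C_NormedModule_mixin_compat2 _ _ _ Hb) as E. simpl in E.
    replace d with (sqrt 2 * (d / sqrt 2)) by (field; lra). exact E.
Qed.

Lemma continuous_CR_eps (g : C -> R) (z : C) :
  continuous g z <->
  forall eps, 0 < eps -> exists delta, 0 < delta /\
    forall w, Cmod (w - z) < delta -> Rabs (g w - g z) < eps.
Proof.
  split.
  - intros H eps He.
    destruct (proj1 (filterlim_locally g (g z)) H (mkposreal _ He)) as [d Hd].
    exists d; split; [apply cond_pos|]. intros w Hw.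
    exact (Hd w (C_NormedModule_mixin_compat1 _ _ _ Hw)).
  - intros H. apply filterlim_locally. intros eps.
    destruct (H eps (cond_pos eps)) as [d [Hd Hw]].
    assert (H2 : 0 < sqrt 2) by (apply sqrt_lt_R0; lra).
    assert (He' : 0 < d / sqrt 2) by (apply Rdiv_lt_0_compat; lra).
    exists (mkposreal _ He'). intros w Hb. apply Hw.
    pose proof (C_NormedModule_mixin_compat2 _ _ _ Hb) as E. simpl in E.
    replace d with (sqrt 2 * (d / sqrt 2)) by (field; lra). exact E.
Qed.

Lemma open_C_eps (D : C -> Prop) :
  open D <-> forall z, D z -> exists delta, 0 < delta /\
    forall w, Cmod (w - z) < delta -> D w.
Proof.
  split; intros H z Hz.
  - destruct (H z Hz) as [d Hd]. exists d; split; [apply cond_pos|].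
    intros w Hw. exact (Hd w (C_NormedModule_mixin_compat1 _ _ _ Hw)).
  - destruct (H z Hz) as [d [Hd Hw]].
    assert (H2 : 0 < sqrt 2) by (apply sqrt_lt_R0; lra).
    assert (He' : 0 < d / sqrt 2) by (apply Rdiv_lt_0_compat; lra).
    exists (mkposreal _ He'). intros w Hb. apply Hw.
    pose proof (C_NormedModule_mixin_compat2 _ _ _ Hb) as E. simpl in E.
    replace d with (sqrt 2 * (d / sqrt 2)) by (field; lra). exact E.
Qed.

(** Here the neighbourhoods are those of the absolute ring, whose balls are [Cmod] discs, so no
    [sqrt 2] appears. *)
Lemma is_derive_C_eps (f : C -> C) (z l : C) :
  is_derive f z l <->
  forall eps, 0 < eps -> exists delta, 0 < delta /\
    forall w, Cmod (w - z) < delta ->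
      Cmod (f w - f z - l * (w - z)) <= eps * Cmod (w - z).
Proof.
  split.
  - intros [_ H] eps He.
    assert (Hf : is_filter_lim (locally (T := AbsRing_UniformSpace C_AbsRing) z) z)
      by (intros P HP; exact HP).
    destruct (H z Hf (mkposreal _ He)) as [d Hd].
    exists d; split; [apply cond_pos|]. intros w Hw.
    specialize (Hd w Hw).
    change (Cmod (f w - f z - (w - z) * l) <= eps * Cmod (w - z)) in Hd.
    rewrite (Cmult_comm l). exact Hd.
  - intros H. split.
    + apply is_linear_scal_l.
    + intros x Hx eps.
      apply (is_filter_lim_locally_unique (K := C_AbsRing) (V := AbsRing_NormedModule C_AbsRing)) in Hx. subst x.
      destruct (H eps (cond_pos eps)) as [d [Hd Hw]].
      exists (mkposreal _ Hd). intros w Hb.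
      change (Cmod (f w - f z - (w - z) * l) <= eps * Cmod (w - z)).
      rewrite (Cmult_comm _ l). apply Hw. exact Hb.
Qed.

Lemma continuous_Cplus (f g : C -> C) (z : C) :
  continuous f z -> continuous g z -> continuous (fun w => f w + g w)%C z.
Proof. intros Hf Hg. exact (continuous_plus (V := C_R_NormedModule) f g z Hf Hg). Qed.

Lemma continuous_Copp (f : C -> C) (z : C) :
  continuous f z -> continuous (fun w => - f w)%C z.
Proof. intros Hf. exact (continuous_opp (V := C_R_NormedModule) f z Hf). Qed.

Lemma continuous_Cminus (f g : C -> C) (z : C) :
  continuous f z -> continuous g z -> continuous (fun w => f w - g w)%C z.
Proof. intros Hf Hg. apply continuous_Cplus; [|apply continuous_Copp]; assumption. Qed.

Lemma continuous_Re (f : C -> C) (z : C) :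
  continuous f z -> continuous (fun w => Re (f w)) z.
Proof.
  intros Hf. apply (continuous_comp f (fun w : C => Re w)); [exact Hf|].
  apply (continuous_fst (U := R_UniformSpace) (V := R_UniformSpace)).
Qed.

Lemma continuous_Im (f : C -> C) (z : C) :
  continuous f z -> continuous (fun w => Im (f w)) z.
Proof.
  intros Hf. apply (continuous_comp f (fun w : C => Im w)); [exact Hf|].
  apply (continuous_snd (U := R_UniformSpace) (V := R_UniformSpace)).
Qed.

Lemma continuous_Re_Im (f : C -> C) (z : C) :
  continuous (fun w => Re (f w)) z -> continuous (fun w => Im (f w)) z ->
  continuous f z.
Proof.
  intros Hr Hi. apply continuous_C_eps. intros eps He.
  destruct (proj1 (continuous_CR_eps _ _) Hr (eps / 2)) as [d1 [Hd1 H1]]; [lra|].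
  destruct (proj1 (continuous_CR_eps _ _) Hi (eps / 2)) as [d2 [Hd2 H2]]; [lra|].
  exists (Rmin d1 d2). split; [apply Rmin_pos; assumption|].
  intros w Hw.
  specialize (H1 w (Rlt_le_trans _ _ _ Hw (Rmin_l _ _))).
  specialize (H2 w (Rlt_le_trans _ _ _ Hw (Rmin_r _ _))).
  pose proof (Cmod_pair_le (Re (f w) - Re (f z)) (Im (f w) - Im (f z))) as H.
  replace (f w - f z)%C with ((Re (f w) - Re (f z), Im (f w) - Im (f z)) : C)
    by (apply injective_projections; unfold Re, Im; simpl; ring).
  lra.
Qed.

Lemma continuous_Cmult (f g : C -> C) (z : C) :
  continuous f z -> continuous g z -> continuous (fun w => f w * g w)%C z.
Proof.
  intros Hf Hg.
  pose proof (continuous_Re _ _ Hf). pose proof (continuous_Im _ _ Hf).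
  pose proof (continuous_Re _ _ Hg). pose proof (continuous_Im _ _ Hg).
  apply continuous_Re_Im.
  - apply (continuous_minus (V := R_NormedModule)
      (fun w => Re (f w) * Re (g w)) (fun w => Im (f w) * Im (g w)));
    apply (continuous_mult (K := R_AbsRing)); assumption.
  - apply (continuous_plus (V := R_NormedModule)
      (fun w => Re (f w) * Im (g w)) (fun w => Im (f w) * Re (g w)));
    apply (continuous_mult (K := R_AbsRing)); assumption.
Qed.

Lemma continuous_Cmod (f : C -> C) (z : C) :
  continuous f z -> continuous (fun w => Cmod (f w)) z.
Proof.
  intros Hf. apply continuous_CR_eps. intros eps He.
  destruct (proj1 (continuous_C_eps _ _) Hf eps He) as [d [Hd H]].
  exists d; split; [exact Hd|]. intros w Hw. specialize (H w Hw).
  pose proof (Cmod_triang_inv (f w) (f z)). lra.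
Qed.

Lemma continuous_Cinv (f : C -> C) (z : C) :
  f z <> RtoC 0 -> continuous f z -> continuous (fun w => / f w)%C z.
Proof.
  intros Hz Hf.
  assert (Hn : Re (f z) ^ 2 + Im (f z) ^ 2 <> 0).
  { intros E. apply Hz. apply injective_projections; unfold Re, Im in E; simpl; nra. }
  pose proof (continuous_Re _ _ Hf) as Hr. pose proof (continuous_Im _ _ Hf) as Hi.
  assert (Hs : continuous (fun w => / (Re (f w) ^ 2 + Im (f w) ^ 2)) z).
  { apply (continuous_comp (fun w => Re (f w) ^ 2 + Im (f w) ^ 2) Rinv).
    - apply (continuous_plus (V := R_NormedModule)
        (fun w => Re (f w) ^ 2) (fun w => Im (f w) ^ 2)).
      + apply (continuous_comp (fun w => Re (f w)) (fun x => x ^ 2)); [exact Hr|].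
        apply (ex_derive_continuous (V := R_NormedModule)). auto_derive; trivial.
      + apply (continuous_comp (fun w => Im (f w)) (fun x => x ^ 2)); [exact Hi|].
        apply (ex_derive_continuous (V := R_NormedModule)). auto_derive; trivial.
    - apply continuous_Rinv. exact Hn. }
  apply continuous_Re_Im.
  - apply (continuous_mult (K := R_AbsRing) (fun w => Re (f w))
      (fun w => / (Re (f w) ^ 2 + Im (f w) ^ 2))); assumption.
  - apply (continuous_mult (K := R_AbsRing) (fun w => - Im (f w))
      (fun w => / (Re (f w) ^ 2 + Im (f w) ^ 2))); [|assumption].
    apply (continuous_opp (V := R_NormedModule) (fun w => Im (f w))). exact Hi.
Qed.

Lemma continuous_ext_locally_C (f g : C -> C) (z : C) (r : R) :
  0 < r -> (forall w, Cmod (w - z) < r -> f w = g w) ->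
  continuous f z -> continuous g z.
Proof.
  intros Hr E Hf. apply continuous_C_eps. intros eps He.
  destruct (proj1 (continuous_C_eps _ _) Hf eps He) as [d [Hd H]].
  exists (Rmin d r). split; [apply Rmin_pos; assumption|]. intros w Hw.
  rewrite <- (E w), <- (E z).
  - apply H. apply Rlt_le_trans with (1 := Hw), Rmin_l.
  - replace (z - z)%C with (RtoC 0) by ring. rewrite Cmod_0. exact Hr.
  - apply Rlt_le_trans with (1 := Hw), Rmin_r.
Qed.

Lemma ex_derive_ext_locally_C (f g : C -> C) (z : C) (r : R) :
  0 < r -> (forall w, Cmod (w - z) < r -> f w = g w) ->
  ex_derive f z -> ex_derive g z.
Proof.
  intros Hr E [l Hf]. exists l. apply is_derive_C_eps. intros eps He.
  destruct (proj1 (is_derive_C_eps _ _ _) Hf eps He) as [d [Hd H]].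
  exists (Rmin d r). split; [apply Rmin_pos; assumption|]. intros w Hw.
  rewrite <- (E w), <- (E z).
  - apply H. apply Rlt_le_trans with (1 := Hw), Rmin_l.
  - replace (z - z)%C with (RtoC 0) by ring. rewrite Cmod_0. exact Hr.
  - apply Rlt_le_trans with (1 := Hw), Rmin_r.
Qed.

(** The difference quotient centred at [a], completed there by [l], which is meant to be the
    derivative: it is then continuous at [a]. *)
Definition slope (f : C -> C) (a l z : C) : C :=
  if Ceq_dec z a then l else ((f z - f a) / (z - a))%C.

Lemma slope_spec (f : C -> C) (a l z : C) :
  (f z - f a = slope f a l z * (z - a))%C.
Proof.
  unfold slope. destruct (Ceq_dec z a) as [->|Hz]; [ring|].
  field. apply Cminus_eq_contra. exact Hz.
Qed.

Lemma slope_at (f : C -> C) (a l : C) : slope f a l a = l.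
Proof. unfold slope. destruct (Ceq_dec a a); congruence. Qed.

(* Caratheodory's characterization of the derivative, from which the algebra
   of complex derivatives reduces to that of continuous functions. *)
Lemma is_derive_C_slope (f : C -> C) (z l : C) :
  is_derive f z l <->
  exists q : C -> C, continuous q z /\ q z = l /\
    forall w, (f w - f z = q w * (w - z))%C.
Proof.
  split.
  - intros H. exists (slope f z l). split; [|split; [apply slope_at|]].
    2: intros w; apply slope_spec.
    apply continuous_C_eps. intros eps He.
    destruct (proj1 (is_derive_C_eps _ _ _) H (eps / 2)) as [d [Hd Hw]]; [lra|].
    exists d; split; [exact Hd|]. intros w Hb. rewrite slope_at.
    unfold slope. destruct (Ceq_dec w z) as [->|Hn].
    + replace (l - l)%C with (RtoC 0) by ring. rewrite Cmod_0. exact He.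
    + assert (Hp : 0 < Cmod (w - z)) by (apply Cmod_gt_0, Cminus_eq_contra, Hn).
      replace ((f w - f z) / (w - z) - l)%C
        with ((f w - f z - l * (w - z)) / (w - z))%C
        by (field; apply Cminus_eq_contra, Hn).
      rewrite Cmod_div by (apply Cminus_eq_contra, Hn).
      apply Rle_lt_trans with (eps / 2); [|lra].
      apply Rle_div_l; [exact Hp|]. apply Hw. exact Hb.
  - intros [q [Hc [<- Hq]]]. apply is_derive_C_eps. intros eps He.
    destruct (proj1 (continuous_C_eps _ _) Hc eps He) as [d [Hd Hw]].
    exists d; split; [exact Hd|]. intros w Hb. rewrite Hq.
    replace (q w * (w - z) - q z * (w - z))%C with ((q w - q z) * (w - z))%C by ring.
    rewrite Cmod_mult. apply Rmult_le_compat_r; [apply Cmod_ge_0|].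
    left. apply Hw. exact Hb.
Qed.

Lemma ex_derive_C_slope (f : C -> C) (z : C) :
  ex_derive f z <->
  exists q : C -> C, continuous q z /\ forall w, (f w - f z = q w * (w - z))%C.
Proof.
  split.
  - intros [l H]. apply is_derive_C_slope in H. destruct H as [q [H1 [_ H2]]].
    exists q; split; assumption.
  - intros [q [H1 H2]]. exists (q z). apply is_derive_C_slope.
    exists q; repeat split; assumption.
Qed.

Lemma ex_derive_C_continuous (f : C -> C) (z : C) : ex_derive f z -> continuous f z.
Proof.
  intros H. apply ex_derive_C_slope in H. destruct H as [q [Hc Hq]].
  apply (continuous_ext (fun w => q w * (w - z) + f z)%C).
  - intros w. change (@eq C (q w * (w - z) + f z)%C (f w)). rewrite <- Hq. ring.
  - apply continuous_Cplus; [|apply continuous_const].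
    apply continuous_Cmult; [exact Hc|].
    apply continuous_Cminus; [apply continuous_id|apply continuous_const].
Qed.

Lemma slope_continuous (f : C -> C) (a l z : C) :
  continuous f z -> z <> a -> continuous (slope f a l) z.
Proof.
  intros Hf Hz.
  assert (Hp : 0 < Cmod (z - a)) by (apply Cmod_gt_0, Cminus_eq_contra, Hz).
  apply (continuous_ext_locally_C (fun w => (f w - f a) / (w - a))%C _ _ _ Hp).
  - intros w Hw. unfold slope. destruct (Ceq_dec w a) as [->|]; [|reflexivity].
    rewrite Cmod_minus_sym in Hw. lra.
  - apply continuous_Cmult.
    + apply continuous_Cminus; [exact Hf|apply continuous_const].
    + apply continuous_Cinv; [apply Cminus_eq_contra, Hz|].
      apply continuous_Cminus; [apply continuous_id|apply continuous_const].
Qed.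

Lemma slope_continuous_at (f : C -> C) (a l : C) :
  is_derive f a l -> continuous (slope f a l) a.
Proof.
  intros H. apply is_derive_C_slope in H. destruct H as [q [Hc [Hl Hq]]].
  apply (continuous_ext q); [|exact Hc]. intros w.
  change (@eq C (q w) (slope f a l w)). unfold slope.
  destruct (Ceq_dec w a) as [->|Hw]; [exact Hl|]. rewrite Hq. field.
  apply Cminus_eq_contra, Hw.
Qed.

Lemma ex_derive_Cconst (c z : C) : ex_derive (fun _ : C => c) z.
Proof.
  apply ex_derive_C_slope. exists (fun _ => RtoC 0).
  split; [apply continuous_const|]. intros w; ring.
Qed.

Lemma ex_derive_Cid (z : C) : ex_derive (fun w : C => w) z.
Proof.
  apply ex_derive_C_slope. exists (fun _ => RtoC 1).
  split; [apply continuous_const|]. intros w; ring.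
Qed.

Lemma ex_derive_Cplus (f g : C -> C) (z : C) :
  ex_derive f z -> ex_derive g z -> ex_derive (fun w => f w + g w)%C z.
Proof.
  intros Hf Hg. apply ex_derive_C_slope in Hf, Hg.
  destruct Hf as [q [Hc Hq]], Hg as [s [Hd Hs]]. apply ex_derive_C_slope.
  exists (fun w => q w + s w)%C. split; [apply continuous_Cplus; assumption|].
  intros w. replace (f w + g w - (f z + g z))%C with ((f w - f z) + (g w - g z))%C by ring.
  rewrite Hq, Hs. ring.
Qed.

Lemma ex_derive_Cmult (f g : C -> C) (z : C) :
  ex_derive f z -> ex_derive g z -> ex_derive (fun w => f w * g w)%C z.
Proof.
  intros Hf Hg. pose proof (ex_derive_C_continuous _ _ Hg) as Hgc.
  apply ex_derive_C_slope in Hf, Hg.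
  destruct Hf as [q [Hc Hq]], Hg as [s [Hd Hs]]. apply ex_derive_C_slope.
  exists (fun w => q w * g w + f z * s w)%C. split.
  - apply continuous_Cplus; apply continuous_Cmult; try assumption.
    apply continuous_const.
  - intros w. replace (f w * g w - f z * g z)%C
      with ((f w - f z) * g w + f z * (g w - g z))%C by ring.
    rewrite Hq, Hs. ring.
Qed.

Lemma ex_derive_Copp (f : C -> C) (z : C) :
  ex_derive f z -> ex_derive (fun w => - f w)%C z.
Proof.
  intros Hf. apply ex_derive_C_slope in Hf. destruct Hf as [q [Hc Hq]].
  apply ex_derive_C_slope. exists (fun w => - q w)%C.
  split; [apply continuous_Copp, Hc|]. intros w.
  replace (- f w - - f z)%C with (- (f w - f z))%C by ring. rewrite Hq. ring.
Qed.

Lemma ex_derive_Cminus (f g : C -> C) (z : C) :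
  ex_derive f z -> ex_derive g z -> ex_derive (fun w => f w - g w)%C z.
Proof. intros Hf Hg. apply ex_derive_Cplus; [|apply ex_derive_Copp]; assumption. Qed.

Lemma ex_derive_Cinv (f : C -> C) (z : C) :
  f z <> RtoC 0 -> ex_derive f z -> ex_derive (fun w => / f w)%C z.
Proof.
  intros Hz Hf. pose proof (ex_derive_C_continuous _ _ Hf) as Hfc.
  assert (Hp : 0 < Cmod (f z)) by (apply Cmod_gt_0, Hz).
  destruct (proj1 (continuous_C_eps _ _) Hfc _ Hp) as [d [Hd Hw]].
  apply ex_derive_C_slope in Hf. destruct Hf as [q [Hc Hq]].
  (* The formula - q(w) / (f(w) f(z)) is valid only near z, since f may vanish elsewhere; [slope] is
     a witness for all w that coincides with it near z. *)
  apply ex_derive_C_slope. exists (slope (fun w => / f w)%C z (- q z / (f z * f z)))%C.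
  split; [|intros w; exact (slope_spec (fun w => / f w)%C z _ w)].
  apply (continuous_ext_locally_C (fun w => - q w * / (f w * f z))%C _ _ _ Hd).
  - intros w Hb. unfold slope. destruct (Ceq_dec w z) as [->|Hn]; [reflexivity|].
    assert (Hfw : f w <> RtoC 0).
    { intros E. specialize (Hw w Hb). rewrite E in Hw.
      replace (RtoC 0 - f z)%C with (- f z)%C in Hw by ring. rewrite Cmod_opp in Hw. lra. }
    pose proof (Cminus_eq_contra _ _ Hn) as Hn'.
    replace (q w) with ((f w - f z) / (w - z))%C by (rewrite Hq; field; exact Hn').
    field.  repeat split; assumption.
  - apply continuous_Cmult; [apply continuous_Copp, Hc|].
    apply continuous_Cinv; [apply Cmult_neq_0; assumption|].
    apply continuous_Cmult; [exact Hfc|apply continuous_const].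
Qed.

Lemma ex_derive_Cdiv (f g : C -> C) (z : C) :
  g z <> RtoC 0 -> ex_derive f z -> ex_derive g z -> ex_derive (fun w => f w / g w)%C z.
Proof. intros Hz Hf Hg. apply ex_derive_Cmult; [|apply ex_derive_Cinv]; assumption. Qed.

Lemma ex_derive_Cpow (f : C -> C) (n : nat) (z : C) :
  ex_derive f z -> ex_derive (fun w => f w ^ n)%C z.
Proof.
  intros Hf. induction n as [|n IH]; simpl.
  - apply ex_derive_Cconst.
  - apply ex_derive_Cmult; assumption.
Qed.

Lemma ex_derive_Ccomp (f g : C -> C) (z : C) :
  ex_derive g z -> ex_derive f (g z) -> ex_derive (fun w => f (g w)) z.
Proof.
  intros Hg Hf. pose proof (ex_derive_C_continuous _ _ Hg) as Hgc.
  apply ex_derive_C_slope in Hf, Hg.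
  destruct Hf as [q [Hc Hq]], Hg as [s [Hd Hs]]. apply ex_derive_C_slope.
  exists (fun w => q (g w) * s w)%C. split.
  - apply continuous_Cmult; [|exact Hd]. apply continuous_comp; assumption.
  - intros w. rewrite Hq, Hs. ring.
Qed.

Lemma slope_ex_derive (f : C -> C) (a l z : C) :
  ex_derive f z -> z <> a -> ex_derive (slope f a l) z.
Proof.
  intros Hf Hz.
  assert (Hp : 0 < Cmod (z - a)) by (apply Cmod_gt_0, Cminus_eq_contra, Hz).
  apply (ex_derive_ext_locally_C (fun w => (f w - f a) / (w - a))%C _ _ _ Hp).
  - intros w Hw. unfold slope. destruct (Ceq_dec w a) as [->|]; [|reflexivity].
    rewrite Cmod_minus_sym in Hw. lra.
  - apply ex_derive_Cdiv; [apply Cminus_eq_contra, Hz| |].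
    + apply ex_derive_Cminus; [exact Hf|apply ex_derive_Cconst].
    + apply ex_derive_Cminus; [apply ex_derive_Cid|apply ex_derive_Cconst].
Qed.

Lemma Cmod_pair_le_Rmax (x y : R) : Cmod (x, y) <= 2 * Rmax (Rabs x) (Rabs y).
Proof.
  pose proof (Cmod_pair_le x y).
  pose proof (Rmax_l (Rabs x) (Rabs y)). pose proof (Rmax_r (Rabs x) (Rabs y)). lra.
Qed.

Lemma is_derive_C_remainder (f : C -> C) (x y : R) (l : C) :
  is_derive f (x, y) l -> forall eps : posreal,
  locally_2d (fun u v =>
    Cmod (f (u, v) - f (x, y) - l * (u - x, v - y)) <=
    eps * Rmax (Rabs (u - x)) (Rabs (v - y))) x y.
Proof.
  intros H eps. assert (He : 0 < eps / 2) by (pose proof (cond_pos eps); lra).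
  destruct (proj1 (is_derive_C_eps _ _ _) H _ He) as [d [Hd Hw]].
  assert (Hd2 : 0 < d / 2) by lra.
  exists (mkposreal _ Hd2). intros u v Hu Hv. simpl in Hu, Hv.
  assert (E : ((u, v) - (x, y) : C)%C = (u - x, v - y)) by reflexivity.
  specialize (Hw (u, v)). rewrite E in Hw.
  pose proof (Cmod_pair_le (u - x) (v - y)).
  pose proof (Cmod_pair_le_Rmax (u - x) (v - y)).
  eapply Rle_trans; [apply Hw; lra|].
  pose proof (cond_pos eps). nra.
Qed.

(** Together with [differentiable_Im] these are the Cauchy-Riemann equations: multiplication by [l]
    written as a real matrix. *)
Lemma differentiable_Re (f : C -> C) (x y : R) (l : C) :
  is_derive f (x, y) l ->
  differentiable_pt_lim (fun u v => Re (f (u, v))) x y (Re l) (- Im l).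
Proof.
  intros H eps. generalize (is_derive_C_remainder f x y l H eps).
  apply locally_2d_impl, locally_2d_forall. intros u v Huv.
  eapply Rle_trans; [|exact Huv]. eapply Rle_trans; [|apply re_le_Cmod].
  right. f_equal. unfold Re, Im; simpl. ring.
Qed.

Lemma differentiable_Im (f : C -> C) (x y : R) (l : C) :
  is_derive f (x, y) l ->
  differentiable_pt_lim (fun u v => Im (f (u, v))) x y (Im l) (Re l).
Proof.
  intros H eps. generalize (is_derive_C_remainder f x y l H eps).
  apply locally_2d_impl, locally_2d_forall. intros u v Huv.
  eapply Rle_trans; [|exact Huv]. eapply Rle_trans; [|apply Rabs_Re_Im_le_Cmod].
  right. f_equal. unfold Re, Im; simpl. ring.
Qed.

Lemma is_derive_Re_line (f : C -> C) (a d u l : C) (t : R) :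
  is_derive f (a + t * d)%C l ->
  is_derive (fun s : R => Re (u * f (a + s * d)%C)) t (Re (u * l * d)%C).
Proof.
  intros H. destruct a as [a1 a2], d as [d1 d2], u as [u1 u2], l as [l1 l2].
  assert (E : forall s : R, ((a1, a2) + s * (d1, d2))%C = (a1 + s * d1, a2 + s * d2) :> C)
    by (intros s; apply injective_projections; simpl; ring).
  rewrite E in H.
  pose proof (differentiable_Re _ _ _ _ H) as HR.
  pose proof (differentiable_Im _ _ _ _ H) as HI.
  assert (D1 : derivable_pt_lim (fun s => a1 + s * d1) t d1)
    by (apply is_derive_Reals; auto_derive; [trivial|ring]).
  assert (D2 : derivable_pt_lim (fun s => a2 + s * d2) t d2)
    by (apply is_derive_Reals; auto_derive; [trivial|ring]).
  pose proof (derivable_pt_lim_comp_2d _ _ _ _ _ _ _ _ HR D1 D2) as K1.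
  pose proof (derivable_pt_lim_comp_2d _ _ _ _ _ _ _ _ HI D1 D2) as K2.
  apply is_derive_Reals in K1, K2. simpl in K1, K2.
  apply (is_derive_ext (fun s => u1 * Re (f (a1 + s * d1, a2 + s * d2))
                              - u2 * Im (f (a1 + s * d1, a2 + s * d2)))).
  - intros s. rewrite E. reflexivity.
  - replace (Re ((u1, u2) * (l1, l2) * (d1, d2))%C)
      with (u1 * (l1 * d1 + - l2 * d2) - u2 * (l2 * d1 + l1 * d2))
      by (unfold Re; simpl; ring).
    apply (is_derive_minus (V := R_NormedModule)
      (fun s => u1 * Re (f (a1 + s * d1, a2 + s * d2)))
      (fun s => u2 * Im (f (a1 + s * d1, a2 + s * d2)))).
    + apply is_derive_scal. exact K1.
    + apply is_derive_scal. exact K2.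
Qed.

(** A rotation [u] makes u (f(b) - f(a)) real and non-negative, so the real mean value theorem for
    Re (u f) along the segment gives the bound. *)
Lemma Cmod_increment_le (f : C -> C) (a b : C) (M : R) :
  (forall t : R, 0 <= t <= 1 -> ex_derive f (a + t * (b - a))%C /\
     Cmod (C_derive f (a + t * (b - a))%C) <= M) ->
  Cmod (f b - f a) <= M * Cmod (b - a).
Proof.
  intros H. destruct (unimodular_rotation (f b - f a)) as [u [Hu Eu]].
  set (d := (b - a)%C) in *.
  assert (HD : forall t : R, 0 <= t <= 1 ->
    is_derive (fun s : R => Re (u * f (a + s * d)%C)) t
      (Re (u * C_derive f (a + t * d)%C * d)%C)).
  { intros t Ht. apply is_derive_Re_line, C_derive_correct; [exact (RtoC 0)|].
    apply H, Ht. }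
  destruct (MVT_gen (fun s : R => Re (u * f (a + s * d)%C)) 0 1
              (fun t => Re (u * C_derive f (a + t * d)%C * d)%C)) as [c [Hc E]].
  - intros x Hx. rewrite Rmin_left, Rmax_right in Hx by lra. apply HD; lra.
  - intros x Hx. rewrite Rmin_left, Rmax_right in Hx by lra.
    apply continuity_pt_filterlim, (ex_derive_continuous (V := R_NormedModule)).
    eexists. apply HD; lra.
  - rewrite Rmin_left, Rmax_right in Hc by lra.
    replace (a + 1%R * d)%C with b in E by (unfold d; ring).
    replace (a + 0%R * d)%C with a in E by ring.
    assert (E1 : Re (u * f b)%C - Re (u * f a)%C = Cmod (f b - f a)).
    { replace (Cmod (f b - f a)) with (Re (u * (f b - f a))%C) by (rewrite Eu; reflexivity).
      unfold Re; simpl; ring. }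
    rewrite E1 in E. rewrite E, Rminus_0_r, Rmult_1_r.
    eapply Rle_trans; [apply Re_le_Cmod|].
    rewrite !Cmod_mult, Hu, Rmult_1_l.
    apply Rmult_le_compat_r; [apply Cmod_ge_0|]. apply H, Hc.
Qed.

(** * Bisection and Goursat's theorem *)

(** [Q x y t] speaks of the box with lower left corner (x, y) and sides t A, t B. If it failed for
    one box, it would fail for nested boxes shrinking to a point, against the local hypothesis
    there. Both compactness and Goursat's theorem are instances. *)
Lemma bisection (A B : R) (Q : R -> R -> R -> Prop) :
  0 <= A -> 0 <= B ->
  (forall x y t, 0 < t ->
     Q x y (t / 2) -> Q (x + t / 2 * A) y (t / 2) ->
     Q x (y + t / 2 * B) (t / 2) -> Q (x + t / 2 * A) (y + t / 2 * B) (t / 2) ->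
     Q x y t) ->
  (forall x0 y0, exists delta, 0 < delta /\ forall x y t, 0 < t < delta ->
     x <= x0 <= x + t * A -> y <= y0 <= y + t * B -> Q x y t) ->
  forall x y t, 0 < t -> Q x y t.
Proof.
  intros HA HB Hsplit Hloc x y t Ht. apply NNPP. intros HQ.
  set (bad := fun (n : nat) (p : R * R) => ~ Q (fst p) (snd p) (t / 2 ^ n)).
  set (next := fun (n : nat) (p q : R * R) =>
    fst p <= fst q <= fst p + t / 2 ^ S n * A /\
    snd p <= snd q <= snd p + t / 2 ^ S n * B).
  assert (Ht2 : forall n, 0 < t / 2 ^ n)
    by (intros n; apply Rdiv_lt_0_compat; [exact Ht|apply pow_lt; lra]).
  assert (Hh : forall n, t / 2 ^ n / 2 = t / 2 ^ S n)
    by (intros n; simpl; field; apply pow_nonzero; lra).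
  assert (step : forall n p, bad n p -> exists q, bad (S n) q /\ next n p q).
  { intros n [px py] Hp. unfold bad, next in *; cbn [fst snd] in *.
    pose proof (Ht2 (S n)) as Hn.
    assert (0 <= t / 2 ^ S n * A) by (apply Rmult_le_pos; lra).
    assert (0 <= t / 2 ^ S n * B) by (apply Rmult_le_pos; lra).
    apply NNPP. intros HN. apply Hp. apply Hsplit; [apply Ht2|..]; rewrite !Hh;
      apply NNPP; intros HN'; apply HN; eexists (_, _); split;
      try exact HN'; cbn [fst snd]; lra. }
  (* The level is packed with the box and the proof that the box is bad, so that the choice function
     is total; [projT1] recovers the level. *)
  destruct (functional_choice
    (fun (a : {n : nat & {p | bad n p}}) (b : {n : nat & {p | bad n p}}) =>
       projT1 b = S (projT1 a) /\ next (projT1 a) (proj1_sig (projT2 a)) (proj1_sig (projT2 b))))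
    as [F HF].
  { intros [n [p Hp]]. destruct (step n p Hp) as [q [Hq Hn]].
    exists (existT _ (S n) (exist _ q Hq)). split; [reflexivity|exact Hn]. }
  assert (H0 : bad 0%nat (x, y)).
  { unfold bad; simpl. replace (t / 1) with t by field. exact HQ. }
  set (u := fix u n := match n with
                       | O => existT (fun n => {p | bad n p}) 0%nat (exist _ (x, y) H0)
                       | S n => F (u n) end).
  assert (Hu1 : forall n, projT1 (u n) = n).
  { induction n as [|n IH]; [reflexivity|]. simpl. rewrite (proj1 (HF (u n))), IH. reflexivity. }
  set (p := fun n => proj1_sig (projT2 (u n))).
  assert (Hbad : forall n, bad n (p n)).
  { intros n. pose proof (proj2_sig (projT2 (u n))) as Hb.
    change (bad (projT1 (u n)) (p n)) in Hb. rewrite Hu1 in Hb. exact Hb. }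
  assert (Hnext : forall n, next n (p n) (p (S n))).
  { intros n. pose proof (proj2 (HF (u n))) as Hb.
    change (next (projT1 (u n)) (p n) (p (S n))) in Hb. rewrite Hu1 in Hb. exact Hb. }
  assert (Hsum : forall n, t / 2 ^ S n + t / 2 ^ S n = t / 2 ^ n)
    by (intros n; simpl; field; apply pow_nonzero; lra).
  assert (Hnest : forall n k,
    fst (p n) <= fst (p (n + k)%nat) /\
    fst (p (n + k)%nat) + t / 2 ^ (n + k) * A <= fst (p n) + t / 2 ^ n * A /\
    snd (p n) <= snd (p (n + k)%nat) /\
    snd (p (n + k)%nat) + t / 2 ^ (n + k) * B <= snd (p n) + t / 2 ^ n * B).
  { intros n k. induction k as [|k IH].
    - rewrite Nat.add_0_r. lra.
    - rewrite Nat.add_succ_r. destruct (Hnext (n + k)%nat) as [H1 H2].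
      pose proof (Hsum (n + k)%nat) as Hs.
      rewrite <- Hs in IH. lra. }
  (* Every left end lies below every right end, so the supremum of the left ends belongs to all the
     intervals. *)
  assert (Hlub : forall (c : nat -> R) D, 0 <= D ->
    (forall n k, c n <= c (n + k)%nat /\
       c (n + k)%nat + t / 2 ^ (n + k) * D <= c n + t / 2 ^ n * D) ->
    exists c0, forall n, c n <= c0 <= c n + t / 2 ^ n * D).
  { intros c D HD Hc.
    assert (Hmix : forall m n, c m <= c n + t / 2 ^ n * D).
    { intros m n. destruct (Nat.le_gt_cases m n) as [Hmn|Hmn].
      - destruct (Hc m (n - m)%nat) as [H1 _].
        replace (m + (n - m))%nat with n in H1 by lia.
        pose proof (Rmult_le_pos _ _ (Rlt_le _ _ (Ht2 n)) HD). lra.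
      - destruct (Hc n (m - n)%nat) as [_ H1].
        replace (n + (m - n))%nat with m in H1 by lia.
        pose proof (Rmult_le_pos _ _ (Rlt_le _ _ (Ht2 m)) HD). lra. }
    destruct (completeness (fun r => exists n, r = c n)) as [c0 [Hub Hl]].
    - exists (c 0%nat + t / 2 ^ 0 * D). intros r [n ->]. apply Hmix.
    - exists (c 0%nat), 0%nat. reflexivity.
    - exists c0. intros n. split.
      + apply Hub. exists n; reflexivity.
      + apply Hl. intros r [m ->]. apply Hmix. }
  destruct (Hlub (fun n => fst (p n)) A HA) as [x0 Hx0].
  { intros n k. split; apply Hnest. }
  destruct (Hlub (fun n => snd (p n)) B HB) as [y0 Hy0].
  { intros n k. split; apply Hnest. }
  destruct (Hloc x0 y0) as [d [Hd HQd]].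
  destruct (pow_lt_1_zero (/ 2)) with (y := d / t) as [N HN].
  { rewrite Rabs_pos_eq; lra. }
  { apply Rdiv_lt_0_compat; assumption. }
  specialize (HN N (Nat.le_refl N)).
  apply (Hbad N). apply HQd; [|apply Hx0|apply Hy0].
  split; [apply Ht2|].
  rewrite pow_inv in HN.
  assert (H2N : 0 < / 2 ^ N) by (apply Rinv_0_lt_compat, pow_lt; lra).
  rewrite Rabs_pos_eq in HN by lra.
  unfold Rdiv. apply Rmult_lt_compat_l with (r := t) in HN; [|exact Ht].
  replace (t * (d / t)) with d in HN by (field; lra). exact HN.
Qed.

(** Without a maximum, every point of K is strictly beaten by another one. Bisection applied to the
    property that a single m in K beats all of K in the box extends this to a box containing K, and
    m would beat itself. *)
Lemma max_on_closed_bounded (K : C -> Prop) (g : C -> R) (r : R) (k : C) :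
  0 < r ->
  (forall z, K z -> Cmod z <= r) ->
  (forall z, ~ K z -> exists delta, 0 < delta /\ forall w, Cmod (w - z) < delta -> ~ K w) ->
  K k -> (forall z, K z -> continuous g z) ->
  exists m, K m /\ forall z, K z -> g z <= g m.
Proof.
  intros Hr Hbd Hcl Hk Hg. apply NNPP. intros HN.
  assert (Hup : forall m, K m -> exists z, K z /\ g m < g z).
  { intros m Hm. apply NNPP. intros HN'. apply HN. exists m. split; [exact Hm|].
    intros z Hz. apply Rnot_lt_le. intros Hlt. apply HN'. exists z; split; assumption. }
  set (Q := fun x y t => exists m, K m /\ forall z, K z ->
    x <= Re z <= x + t * (2 * r) -> y <= Im z <= y + t * (2 * r) -> g z < g m).
  assert (HQ : Q (- r) (- r) 1).
  { apply (bisection (2 * r) (2 * r) Q); try lra.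
    - intros x y t Ht [m1 [K1 H1]] [m2 [K2 H2]] [m3 [K3 H3]] [m4 [K4 H4]].
      assert (Hmax : forall m m', K m -> K m' -> exists m'', K m'' /\ g m <= g m'' /\ g m' <= g m'').
      { intros m m' Hm Hm'. destruct (Rle_dec (g m) (g m')) as [H|H].
        - exists m'; repeat split; try assumption; lra.
        - exists m; repeat split; try assumption; lra. }
      destruct (Hmax m1 m2 K1 K2) as [m5 [K5 H5]].
      destruct (Hmax m3 m4 K3 K4) as [m6 [K6 H6]].
      destruct (Hmax m5 m6 K5 K6) as [m [Km Hm]].
      exists m; split; [exact Km|]. intros z Kz Hx Hy.
      destruct (Rle_dec (Re z) (x + t / 2 * (2 * r))) as [Hx'|Hx'],
               (Rle_dec (Im z) (y + t / 2 * (2 * r))) as [Hy'|Hy'].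
      + apply Rlt_le_trans with (g m1); [apply H1; [exact Kz|lra|lra]|lra].
      + apply Rlt_le_trans with (g m3); [apply H3; [exact Kz|lra|lra]|lra].
      + apply Rlt_le_trans with (g m2); [apply H2; [exact Kz|lra|lra]|lra].
      + apply Rlt_le_trans with (g m4); [apply H4; [exact Kz|lra|lra]|lra].
    - intros x0 y0. destruct (classic (K (x0, y0))) as [H0|H0].
      + destruct (Hup _ H0) as [m [Km Hm]].
        destruct (proj1 (continuous_CR_eps g (x0, y0)) (Hg _ H0) (g m - g (x0, y0)))
          as [d [Hd Hw]]; [lra|].
        (* At such scales the sides, t (2 r), are below d / 2, so the box lies in the disc of radius
           d about (x0, y0). *)
        exists (d / (4 * r)). split; [apply Rdiv_lt_0_compat; lra|].
        intros x y t Ht Hx Hy. exists m; split; [exact Km|]. intros [zx zy] Kz Hzx Hzy.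
        unfold Re, Im in *; simpl in Hzx, Hzy.
        assert (Htr : t * (2 * r) < d / 2).
        { replace (d / 2) with (d / (4 * r) * (2 * r)) by (field; lra).
          apply Rmult_lt_compat_r; lra. }
        assert (Hb : Rabs (g (zx, zy) - g (x0, y0)) < g m - g (x0, y0)).
        { apply Hw. eapply Rle_lt_trans; [apply (Cmod_pair_le (zx - x0) (zy - y0))|].
          assert (Rabs (zx - x0) < d / 2) by (apply Rabs_def1; lra).
          assert (Rabs (zy - y0) < d / 2) by (apply Rabs_def1; lra). lra. }
        apply Rabs_def2 in Hb. lra.
      + destruct (Hcl _ H0) as [d [Hd Hw]].
        exists (d / (4 * r)). split; [apply Rdiv_lt_0_compat; lra|].
        intros x y t Ht Hx Hy. exists k; split; [exact Hk|]. intros [zx zy] Kz Hzx Hzy.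
        unfold Re, Im in *; simpl in Hzx, Hzy. exfalso.
        assert (Htr : t * (2 * r) < d / 2).
        { replace (d / 2) with (d / (4 * r) * (2 * r)) by (field; lra).
          apply Rmult_lt_compat_r; lra. }
        apply (Hw (zx, zy)); [|exact Kz].
        eapply Rle_lt_trans; [apply (Cmod_pair_le (zx - x0) (zy - y0))|].
        assert (Rabs (zx - x0) < d / 2) by (apply Rabs_def1; lra).
        assert (Rabs (zy - y0) < d / 2) by (apply Rabs_def1; lra). lra. }
  destruct HQ as [m [Km Hm]].
  assert (g m < g m); [|lra].
  pose proof (Rabs_Re_Im_le_Cmod m) as [H1 H2]. pose proof (Hbd m Km).
  apply Hm; [exact Km| |]; apply Rabs_le_between in H1, H2; lra.
Qed.

(** Outward flux of the field (U, W) through the boundary of the rectangle [a, b] x [c, d]. *)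
Definition flux (U W : R -> R -> R) (a b c d : R) : R :=
  (RInt (U b) c d - RInt (U a) c d) +
  (RInt (fun x => W x d) a b - RInt (fun x => W x c) a b).

Lemma differentiable_pt_lim_continuous_2 (U : R -> R -> R) (x y lx ly : R) :
  differentiable_pt_lim U x y lx ly -> continuous (U x) y.
Proof.
  intros H. apply (ex_derive_continuous (V := R_NormedModule)). eexists.
  apply is_derive_Reals.
  apply (derivable_pt_lim_comp_2d U (fun _ => x) (fun s => s) y lx ly 0 1 H).
  - apply is_derive_Reals. apply (is_derive_const (V := R_NormedModule)).
  - apply is_derive_Reals. apply (is_derive_id (K := R_AbsRing)).
Qed.

Lemma differentiable_pt_lim_continuous_1 (U : R -> R -> R) (x y lx ly : R) :
  differentiable_pt_lim U x y lx ly -> continuous (fun s => U s y) x.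
Proof.
  intros H. apply (ex_derive_continuous (V := R_NormedModule)). eexists.
  apply is_derive_Reals.
  apply (derivable_pt_lim_comp_2d U (fun s => s) (fun _ => y) x lx ly 1 0 H).
  - apply is_derive_Reals. apply (is_derive_id (K := R_AbsRing)).
  - apply is_derive_Reals. apply (is_derive_const (V := R_NormedModule)).
Qed.

Lemma RInt_near_const (g : R -> R) (a b k e : R) :
  a <= b -> ex_RInt g a b -> (forall x, a <= x <= b -> Rabs (g x - k) <= e) ->
  Rabs (RInt g a b - k * (b - a)) <= e * (b - a).
Proof.
  intros Hab Hg H.
  assert (E : RInt (fun x => g x - k) a b = RInt g a b - k * (b - a)).
  { rewrite (RInt_minus (V := R_CompleteNormedModule) g (fun _ => k));
      [|exact Hg|apply ex_RInt_const].
    rewrite RInt_const. unfold minus, plus, opp, scal; simpl. unfold mult; simpl. ring. }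
  rewrite <- E, Rmult_comm. apply abs_RInt_le_const; try assumption.
  apply (ex_RInt_minus (V := R_NormedModule) g (fun _ => k)); [exact Hg|apply ex_RInt_const].
Qed.

(* Goursat's bisection argument: the derivatives need not be continuous. *)
Lemma flux_divergence_free (U W : R -> R -> R) (a b c d : R) :
  a < b -> c < d ->
  (forall x y, a <= x <= b -> c <= y <= d -> exists l m n,
     differentiable_pt_lim U x y l m /\ differentiable_pt_lim W x y n (- l)) ->
  flux U W a b c d = 0.
Proof.
  intros Hab Hcd HD.
  assert (IU : forall x c' d', a <= x <= b -> c <= c' -> c' <= d' -> d' <= d ->
    ex_RInt (U x) c' d').
  { intros x c' d' Hx H1 H2 H3. apply (ex_RInt_continuous (V := R_CompleteNormedModule)).
    intros y Hy. rewrite Rmin_left, Rmax_right in Hy by lra.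
    destruct (HD x y) as [l [m [n [Hd _]]]]; [lra|lra|].
    eapply differentiable_pt_lim_continuous_2, Hd. }
  assert (IW : forall y a' b', c <= y <= d -> a <= a' -> a' <= b' -> b' <= b ->
    ex_RInt (fun x => W x y) a' b').
  { intros y a' b' Hy H1 H2 H3. apply (ex_RInt_continuous (V := R_CompleteNormedModule)).
    intros x Hx. rewrite Rmin_left, Rmax_right in Hx by lra.
    destruct (HD x y) as [l [m [n [_ Hd]]]]; [lra|lra|].
    eapply differentiable_pt_lim_continuous_1, Hd. }
  set (A := b - a). set (B := d - c).
  assert (HA : 0 < A) by (unfold A; lra). assert (HB : 0 < B) by (unfold B; lra).
  assert (key : forall eps, 0 < eps -> Rabs (flux U W a b c d) <= eps).
  { intros eps He.
    (* The tolerance [eps * (t * t)] scales like the area, so those of the four half-size boxes add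
       up to it exactly. *)
    set (Q := fun x y t => a <= x -> x + t * A <= b -> c <= y -> y + t * B <= d ->
      Rabs (flux U W x (x + t * A) y (y + t * B)) <= eps * (t * t)).
    assert (HQ : Q a c 1).
    { apply (bisection A B Q); try lra.
      - intros x y t Ht Q1 Q2 Q3 Q4 Hx Hx' Hy Hy'.
        unfold Q in *.
        replace (x + t / 2 * A + t / 2 * A) with (x + t * A) in * by field.
        replace (y + t / 2 * B + t / 2 * B) with (y + t * B) in * by field.
        assert (0 <= t / 2 * A) by (apply Rmult_le_pos; lra).
        assert (0 <= t / 2 * B) by (apply Rmult_le_pos; lra).
        assert (EA : t * A = t / 2 * A + t / 2 * A) by field.
        assert (EB : t * B = t / 2 * B + t / 2 * B) by field.
        specialize (Q1 ltac:(lra) ltac:(lra) ltac:(lra) ltac:(lra)).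
        specialize (Q2 ltac:(lra) ltac:(lra) ltac:(lra) ltac:(lra)).
        specialize (Q3 ltac:(lra) ltac:(lra) ltac:(lra) ltac:(lra)).
        specialize (Q4 ltac:(lra) ltac:(lra) ltac:(lra) ltac:(lra)).
        set (xm := x + t / 2 * A) in *. set (xe := x + t * A) in *.
        set (ym := y + t / 2 * B) in *. set (ye := y + t * B) in *.
        assert (x <= xm <= xe) by (unfold xm, xe; lra).
        assert (y <= ym <= ye) by (unfold ym, ye; lra).
        assert (E : flux U W x xe y ye = flux U W x xm y ym + flux U W xm xe y ym
                  + flux U W x xm ym ye + flux U W xm xe ym ye).
        { unfold flux.
          rewrite <- (RInt_Chasles (V := R_CompleteNormedModule) (U xe) y ym ye)
            by (apply IU; lra).
          rewrite <- (RInt_Chasles (V := R_CompleteNormedModule) (U x) y ym ye)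
            by (apply IU; lra).
          rewrite <- (RInt_Chasles (V := R_CompleteNormedModule) (fun s => W s ye) x xm xe)
            by (apply IW; lra).
          rewrite <- (RInt_Chasles (V := R_CompleteNormedModule) (fun s => W s y) x xm xe)
            by (apply IW; lra).
          unfold plus; simpl. ring. }
        rewrite E.
        pose proof (Rabs_triang (flux U W x xm y ym + flux U W xm xe y ym
                  + flux U W x xm ym ye) (flux U W xm xe ym ye)).
        pose proof (Rabs_triang (flux U W x xm y ym + flux U W xm xe y ym)
                     (flux U W x xm ym ye)).
        pose proof (Rabs_triang (flux U W x xm y ym) (flux U W xm xe y ym)).
        nra.
      - intros x0 y0.
        destruct (classic (a <= x0 <= b /\ c <= y0 <= d)) as [[Hx0 Hy0]|HN].
        2:{ exists 1. split; [lra|]. intros x y t Ht Hx Hy Q1 Q2 Q3 Q4.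
            exfalso. apply HN. lra. }
        destruct (HD x0 y0 Hx0 Hy0) as [l [m [n [DU DW]]]].
        (* Two opposite sides contribute an error 2 e t (A + B) times their length, t A or t B; the
           total is 2 e t^2 (A + B)^2 = eps t^2. *)
        set (e := eps / (2 * (A + B) * (A + B))).
        assert (Hep : 0 < e) by (apply Rdiv_lt_0_compat; nra).
        destruct (DU (mkposreal _ Hep)) as [d1 H1].
        destruct (DW (mkposreal _ Hep)) as [d2 H2].
        exists (Rmin d1 d2 / (A + B)).
        assert (Hd12 : 0 < Rmin d1 d2) by (apply Rmin_pos; apply cond_pos).
        split; [apply Rdiv_lt_0_compat; lra|].
        intros x y t Ht Hx Hy Q1 Q2 Q3 Q4.
        assert (HtAB : t * (A + B) < Rmin d1 d2) by (apply Rlt_div_r; lra).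
        pose proof (Rmin_l d1 d2). pose proof (Rmin_r d1 d2).
        assert (0 < t * A) by (apply Rmult_lt_0_compat; lra).
        assert (0 < t * B) by (apply Rmult_lt_0_compat; lra).
        assert (Hbox : forall u v, x <= u <= x + t * A -> y <= v <= y + t * B ->
          Rabs (U u v - U x0 y0 - (l * (u - x0) + m * (v - y0))) <= e * (t * (A + B)) /\
          Rabs (W u v - W x0 y0 - (n * (u - x0) + - l * (v - y0))) <= e * (t * (A + B))).
        { intros u v Hu Hv.
          assert (Rabs (u - x0) <= t * A) by (apply Rabs_le; lra).
          assert (Rabs (v - y0) <= t * B) by (apply Rabs_le; lra).
          assert (Hm : Rmax (Rabs (u - x0)) (Rabs (v - y0)) <= t * (A + B))
            by (apply Rmax_lub; lra).
          split; (eapply Rle_trans; [(apply H1 || apply H2); lra|]);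
            simpl; apply Rmult_le_compat_l; lra. }
        set (xe := x + t * A) in *. set (ye := y + t * B) in *.
        assert (Exe : xe - x = t * A) by (unfold xe; ring).
        assert (Eye : ye - y = t * B) by (unfold ye; ring).
        pose proof (IU xe y ye ltac:(lra) ltac:(lra) ltac:(lra) ltac:(lra)) as I1.
        pose proof (IU x y ye ltac:(lra) ltac:(lra) ltac:(lra) ltac:(lra)) as I2.
        pose proof (IW ye x xe ltac:(lra) ltac:(lra) ltac:(lra) ltac:(lra)) as I3.
        pose proof (IW y x xe ltac:(lra) ltac:(lra) ltac:(lra) ltac:(lra)) as I4.
        unfold flux.
        rewrite <- (RInt_minus (V := R_CompleteNormedModule) (U xe) (U x)) by assumption.
        rewrite <- (RInt_minus (V := R_CompleteNormedModule)
          (fun s => W s ye) (fun s => W s y)) by assumption.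
        (* The linear parts give [l * (t * A) * (t * B)] here and its opposite in [B2]: this is
           where the vanishing divergence enters. *)
        assert (B1 : Rabs (RInt (fun v => minus (U xe v) (U x v)) y ye - l * (t * A) * (ye - y))
                     <= 2 * (e * (t * (A + B))) * (ye - y)).
        { apply RInt_near_const; [lra| |].
          - apply (ex_RInt_minus (V := R_NormedModule) (U xe) (U x)); assumption.
          - intros v Hv. destruct (Hbox xe v) as [E1 _]; [lra|lra|].
            destruct (Hbox x v) as [E2 _]; [lra|lra|].
            unfold minus, plus, opp; simpl.
            apply Rabs_le_between in E1, E2. rewrite <- Exe. apply Rabs_le; lra. }
        assert (B2 : Rabs (RInt (fun u => minus (W u ye) (W u y)) x xe - (- l * (t * B)) * (xe - x))
                     <= 2 * (e * (t * (A + B))) * (xe - x)).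
        { apply RInt_near_const; [lra| |].
          - apply (ex_RInt_minus (V := R_NormedModule) (fun s => W s ye) (fun s => W s y));
              assumption.
          - intros v Hv. destruct (Hbox v ye) as [_ E1]; [lra|lra|].
            destruct (Hbox v y) as [_ E2]; [lra|lra|].
            unfold minus, plus, opp; simpl.
            apply Rabs_le_between in E1, E2. rewrite <- Eye. apply Rabs_le; lra. }
        rewrite Exe, Eye in *.
        replace (eps * (t * t)) with
          (2 * (e * (t * (A + B))) * (t * B) + 2 * (e * (t * (A + B))) * (t * A))
          by (unfold e; field; lra).
        assert (F : forall p q r1 r2 k1 k2 : R, Rabs (p - k1) <= r1 -> Rabs (q - k2) <= r2 ->
          k1 = - k2 -> Rabs (p + q) <= r1 + r2).
        { intros p q r1 r2 k1 k2 F1 F2 F3. apply Rabs_le_between in F1, F2.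
          apply Rabs_le; lra. }
        apply (F _ _ _ _ _ _ B1 B2). ring. }
    unfold Q in HQ. replace (a + 1 * A) with b in HQ by (unfold A; ring).
    replace (c + 1 * B) with d in HQ by (unfold B; ring). lra. }
  apply Rabs_eq_0. apply Rle_antisym; [|apply Rabs_pos].
  apply le_epsilon. intros eps He. rewrite Rplus_0_l. apply key, He.
Qed.

(** * The maximum principle *)

Lemma differentiable_pt_lim_affine_mult (c x y : R) :
  differentiable_pt_lim (fun u v => c + u * v) x y y x.
Proof.
  intros eps. exists eps. intros u v Hu Hv.
  replace (c + u * v - (c + x * y) - (y * (u - x) + x * (v - y)))
    with ((u - x) * (v - y)) by ring.
  rewrite Rabs_mult. apply Rmult_le_compat; try apply Rabs_pos; [lra|apply Rmax_r].
Qed.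

Lemma differentiable_pt_lim_proj2 (f : R -> R) (x y l : R) :
  is_derive f y l -> differentiable_pt_lim (fun _ v => f v) x y 0 l.
Proof.
  intros H. apply is_derive_Reals in H.
  pose proof (differentiable_pt_lim_proj1_0 f y x l H) as D.
  intros eps. destruct (D eps) as [d Hd]. exists d. intros u v Hu Hv.
  specialize (Hd v u Hv Hu). simpl in Hd. rewrite Rmax_comm in Hd.
  rewrite Rmult_0_l, Rplus_0_l. rewrite Rmult_0_l, Rplus_0_r in Hd. exact Hd.
Qed.

Lemma differentiable_polar (c s t : R) (g : R -> R) (l : R) :
  is_derive g t l ->
  differentiable_pt_lim (fun u v => c + u * g v) s t (g t) (s * l).
Proof.
  intros Hg.
  assert (D1 : differentiable_pt_lim (fun u _ : R => u) s t 1 0).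
  { apply (differentiable_pt_lim_proj1_0 (fun u => u)), derivable_pt_lim_id. }
  pose proof (differentiable_pt_lim_proj2 g s t l Hg) as D2.
  pose proof (differentiable_pt_lim_comp (fun u v => c + u * v) (fun u _ => u) (fun _ v => g v)
    s t _ _ _ _ _ _ (differentiable_pt_lim_affine_mult c s (g t)) D1 D2) as D.
  replace (g t) with (g t * 1 + s * 0) by ring.
  replace (s * l) with (g t * 0 + s * l) by ring. exact D.
Qed.

Definition circle_point (z : C) (s t : R) : C := (Re z + s * cos t, Im z + s * sin t).

Lemma Cmod_circle_point (z : C) (s t : R) :
  0 <= s -> Cmod (circle_point z s t - z) = s.
Proof.
  intros Hs.
  replace (circle_point z s t - z)%C with ((s * cos t, s * sin t) : C)
    by (apply injective_projections; unfold circle_point, Re, Im; simpl; ring).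
  unfold Cmod; simpl.
  replace (s * cos t * (s * cos t * 1) + s * sin t * (s * sin t * 1))
    with (s * s * ((sin t) * (sin t) + cos t * cos t)) by ring.
  pose proof (sin2_cos2 t) as E. unfold Rsqr in E. rewrite E, Rmult_1_r.
  apply sqrt_square, Hs.
Qed.

(** Re f has the same angular integral over concentric circles. If Re f(z) > m, continuity keeps Re
    f above the midpoint of m and Re f(z) on a small circle, while it is at most m on the circle of
    radius s. *)
Lemma mean_value_inequality (f : C -> C) (z : C) (s m : R) :
  0 < s ->
  (forall w, Cmod (w - z) <= s -> ex_derive f w) ->
  (forall w, Cmod (w - z) = s -> Re (f w) <= m) ->
  Re (f z) <= m.
Proof.
  intros Hs Hf Hm. apply Rnot_lt_le. intros Hlt.
  assert (Hz : ex_derive f z).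
  { apply Hf. replace (z - z)%C with (RtoC 0) by ring. rewrite Cmod_0; lra. }
  destruct (proj1 (continuous_CR_eps _ _)
    (continuous_Re _ _ (ex_derive_C_continuous _ _ Hz)) ((Re (f z) - m) / 2)) as [d [Hd Hw]];
    [lra|].
  (* The flux is taken over s0 <= u <= s, away from u = 0 where the polar field is singular. *)
  set (s0 := Rmin d s / 2).
  assert (Hs0 : 0 < s0 /\ s0 < d /\ s0 < s).
  { pose proof (Rmin_pos d s Hd Hs). pose proof (Rmin_l d s). pose proof (Rmin_r d s).
    unfold s0. lra. }
  (* By the Cauchy-Riemann equations in the polar coordinates (u, v), the field
     (Re f, - Im f / u) is divergence free. *)
  set (U := fun u v => Re (f (circle_point z u v))).
  set (W := fun u v => 0 + - / u * Im (f (circle_point z u v))).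
  assert (HD : forall u v, s0 <= u <= s -> 0 <= v <= 2 * PI -> exists l k n,
     differentiable_pt_lim U u v l k /\ differentiable_pt_lim W u v n (- l)).
  { intros u v Hu Hv.
    destruct (Hf (circle_point z u v)) as [l Hl].
    { rewrite Cmod_circle_point; lra. }
    pose proof (differentiable_polar (Re z) u v cos _ (is_derive_cos v)) as DX.
    pose proof (differentiable_polar (Im z) u v sin _ (is_derive_sin v)) as DY.
    pose proof (differentiable_pt_lim_comp _ _ _ u v _ _ _ _ _ _
      (differentiable_Re _ _ _ _ Hl) DX DY) as DU.
    pose proof (differentiable_pt_lim_comp _ _ _ u v _ _ _ _ _ _
      (differentiable_Im _ _ _ _ Hl) DX DY) as DI.
    assert (D1 : differentiable_pt_lim (fun u _ : R => - / u) u v (/ (u * u)) 0).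
    { apply (differentiable_pt_lim_proj1_0 (fun u => - / u)).
      apply is_derive_Reals. auto_derive; [lra|field; lra]. }
    pose proof (differentiable_pt_lim_comp _ _ _ u v _ _ _ _ _ _
      (differentiable_pt_lim_affine_mult 0 _ _) D1 DI) as DW.
    do 3 eexists. split; [exact DU|].
    match type of DW with differentiable_pt_lim _ _ _ _ ?q =>
      match goal with |- differentiable_pt_lim _ _ _ _ ?r =>
        replace r with q by (field; lra) end end.
    exact DW. }
  pose proof PI_RGT_0 as Hpi.
  pose proof (flux_divergence_free U W s0 s 0 (2 * PI) ltac:(lra) ltac:(lra) HD) as E.
  assert (IU : forall u, s0 <= u <= s -> ex_RInt (U u) 0 (2 * PI)).
  { intros u Hu. apply (ex_RInt_continuous (V := R_CompleteNormedModule)).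
    intros v Hv. rewrite Rmin_left, Rmax_right in Hv by lra.
    destruct (HD u v Hu Hv) as [l [k [n [D _]]]].
    eapply differentiable_pt_lim_continuous_2, D. }
  (* The sides v = 0 and v = 2 PI are the same segment of the plane, so they cancel and the
     vanishing flux equates the integrals over the two circles. *)
  assert (EW : RInt (fun u => W u (2 * PI)) s0 s = RInt (fun u => W u 0) s0 s).
  { apply RInt_ext. intros u _. unfold W, circle_point.
    rewrite cos_2PI, sin_2PI, cos_0, sin_0. reflexivity. }
  unfold flux in E. rewrite EW in E.
  assert (B1 : RInt (U s) 0 (2 * PI) <= m * (2 * PI)).
  { replace (m * (2 * PI)) with (RInt (fun _ => m) 0 (2 * PI))
      by (rewrite RInt_const; unfold scal; simpl; unfold mult; simpl; ring).
    apply RInt_le; [lra|apply IU; lra|apply ex_RInt_const|].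
    intros v _. apply Hm. apply Cmod_circle_point; lra. }
  assert (B2 : (m + (Re (f z) - m) / 2) * (2 * PI) <= RInt (U s0) 0 (2 * PI)).
  { replace ((m + (Re (f z) - m) / 2) * (2 * PI))
      with (RInt (fun _ => m + (Re (f z) - m) / 2) 0 (2 * PI))
      by (rewrite RInt_const; unfold scal; simpl; unfold mult; simpl; ring).
    apply RInt_le; [lra|apply ex_RInt_const|apply IU; lra|].
    intros v _. specialize (Hw (circle_point z s0 v)).
    rewrite Cmod_circle_point in Hw by lra. specialize (Hw ltac:(lra)).
    apply Rabs_def2 in Hw. unfold U. lra. }
  assert (0 < (Re (f z) - m) / 2 * (2 * PI)) by (apply Rmult_lt_0_compat; lra).
  lra.
Qed.

Lemma closed_circle (r : R) (z : C) :
  Cmod z <> r -> exists delta, 0 < delta /\ forall w, Cmod (w - z) < delta -> Cmod w <> r.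
Proof.
  intros Hz. exists (Rabs (Cmod z - r)). split; [apply Rabs_pos_lt; lra|].
  intros w Hw E. pose proof (Cmod_triang_inv w z). rewrite E in H.
  rewrite Rabs_minus_sym in H. lra.
Qed.

Lemma closed_closed_disc (r : R) (z : C) :
  ~ Cmod z <= r -> exists delta, 0 < delta /\ forall w, Cmod (w - z) < delta -> ~ Cmod w <= r.
Proof.
  intros Hz. exists (Cmod z - r). split; [lra|].
  intros w Hw E. pose proof (Cmod_triang_inv w z).
  apply Rabs_le_between in H. lra.
Qed.

(* At an interior maximum m of |h| + eps |z|^2, the holomorphic function
   u h + 2 eps conj(m) (z - m), with u rotating h(m) to |h(m)|, has real part
   less than |h(m)| on small circles around m. *)
Lemma max_modulus (h : C -> C) (r B : R) :
  0 < r ->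
  (forall z, Cmod z <= r -> continuous h z) ->
  (forall z, Cmod z < r -> h z <> RtoC 0 -> ex_derive h z) ->
  (forall z, Cmod z = r -> Cmod (h z) <= B) ->
  forall z, Cmod z <= r -> Cmod (h z) <= B.
Proof.
  intros Hr Hc Hd HB z Hz.
  assert (HB0 : 0 <= B).
  { apply Rle_trans with (Cmod (h (RtoC r))); [apply Cmod_ge_0|].
    apply HB. rewrite Cmod_R. apply Rabs_pos_eq; lra. }
  apply le_epsilon. intros eps' He'.
  set (eps := eps' / (r * r)).
  assert (He : 0 < eps) by (apply Rdiv_lt_0_compat; nra).
  assert (Eeps : eps * (r * r) = eps') by (unfold eps; field; lra).
  clearbody eps. subst eps'.
  destruct (max_on_closed_bounded (fun w => Cmod w <= r)
    (fun w => Cmod (h w) + eps * (Cmod w * Cmod w)) r (RtoC 0) Hr) as [m [Hm Hmax]].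
  - intros w Hw; exact Hw.
  - apply closed_closed_disc.
  - rewrite Cmod_0; lra.
  - intros w Hw. apply (continuous_plus (V := R_NormedModule)
      (fun w => Cmod (h w)) (fun w => eps * (Cmod w * Cmod w))).
    + apply continuous_Cmod, Hc, Hw.
    + apply (continuous_scal_r (V := R_NormedModule) eps (fun w => Cmod w * Cmod w)).
      apply (continuous_mult (K := R_AbsRing)); apply (continuous_Cmod (fun w => w));
        apply continuous_id.
  - assert (Hsq : forall w, Cmod w <= r -> Cmod w * Cmod w <= r * r).
    { intros w Hw. pose proof (Cmod_ge_0 w). nra. }
    assert (Hend : Cmod (h m) <= B -> Cmod (h z) <= B + eps * (r * r)).
    { intros Hhm. pose proof (Hmax z Hz) as H1. pose proof (Hsq m Hm) as H2.
      pose proof (Rmult_le_compat_l eps _ _ (Rlt_le _ _ He) H2).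
      assert (0 <= eps * (Cmod z * Cmod z))
        by (apply Rmult_le_pos; [lra|pose proof (Cmod_ge_0 z); nra]).
      lra. }
    destruct (Req_dec (Cmod m) r) as [Er|Nr]; [apply Hend, HB, Er|].
    destruct (Ceq_dec (h m) (RtoC 0)) as [E0|N0].
    { apply Hend. rewrite E0, Cmod_0. exact HB0. }
    exfalso.
    assert (Hhm : 0 < Cmod (h m)) by (apply Cmod_gt_0, N0).
    destruct (proj1 (continuous_C_eps _ _) (Hc m Hm) _ Hhm) as [d [Hdp Hw]].
    destruct (unimodular_rotation (h m)) as [u [Hu Eu]].
    set (s := Rmin d (r - Cmod m) / 2).
    assert (Hs : 0 < s /\ s < d /\ s < r - Cmod m).
    { assert (Hrm : 0 < r - Cmod m) by lra.
      pose proof (Rmin_pos _ _ Hdp Hrm). pose proof (Rmin_l d (r - Cmod m)).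
      pose proof (Rmin_r d (r - Cmod m)). unfold s. lra. }
    assert (Hin : forall w, Cmod (w - m) <= s -> Cmod w < r /\ h w <> RtoC 0).
    { intros w Hwm. split.
      - pose proof (Cmod_triang_inv w m) as H1. apply Rabs_le_between in H1. lra.
      - intros E. specialize (Hw w ltac:(lra)). rewrite E in Hw.
        replace (RtoC 0 - h m)%C with (- h m)%C in Hw by ring.
        rewrite Cmod_opp in Hw. lra. }
    set (F := fun w => (u * h w + RtoC (2 * eps) * (Cconj m * (w - m)))%C).
    (* On the circle |w|^2 - |m|^2 = 2 Re (conj(m) (w - m)) + s^2. The linear term of [F] absorbs
       the first summand, and - eps s^2 remains. *)
    assert (HF : Re (F m) <= Cmod (h m) - eps * (s * s)).
    { apply (mean_value_inequality F m s); [lra| |].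
      - intros w Hwm. destruct (Hin w Hwm) as [H1 H2]. unfold F.
        apply ex_derive_Cplus.
        + apply ex_derive_Cmult; [apply ex_derive_Cconst|apply Hd; assumption].
        + apply ex_derive_Cmult; [apply ex_derive_Cconst|].
          apply ex_derive_Cmult; [apply ex_derive_Cconst|].
          apply ex_derive_Cminus; [apply ex_derive_Cid|apply ex_derive_Cconst].
      - intros w Hwm. destruct (Hin w ltac:(lra)) as [H1 H2].
        pose proof (Hmax w ltac:(lra)) as H3. cbv beta in H3.
        rewrite !Cmod_sqr in H3.
        pose proof (Cmod_sqr (w - m)) as H4. rewrite Hwm in H4.
        pose proof (Re_le_Cmod (u * h w)) as H5. rewrite Cmod_mult, Hu in H5.
        assert (EF : Re (F w) = Re (u * h w) + 2 * eps *
                   (Re m * (Re w - Re m) + Im m * (Im w - Im m))).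
        { unfold F. destruct (u * h w)%C, m, w. unfold Re, Im; simpl. ring. }
        rewrite EF. rewrite H4.
        assert (ER : Re (w - m) = Re w - Re m) by reflexivity.
        assert (EI : Im (w - m) = Im w - Im m) by reflexivity.
        rewrite ER, EI.
        lra. }
    assert (EFm : Re (F m) = Cmod (h m)).
    { unfold F. rewrite Eu. replace (m - m)%C with (RtoC 0) by ring.
      unfold Re; simpl. ring. }
    assert (0 < eps * (s * s)) by (apply Rmult_lt_0_compat; nra).
    lra.
Qed.

(** If x > y > 0, the powers of x / y would exceed d / c. The exponent [S n] rules out 0^0, so that
    y = 0 is settled by n = 0. *)
Lemma pow_ratio_le (x y c d : R) :
  0 <= x -> 0 <= y -> 0 < c -> (forall n, x ^ S n * c <= y ^ S n * d) -> x <= y.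
Proof.
  intros Hx Hy Hc H. apply Rnot_lt_le. intros Hlt.
  assert (Hd : 0 < d).
  { specialize (H 0%nat). simpl in H. nra. }
  destruct (Rle_lt_or_eq_dec 0 y Hy) as [Hy0|Hy0].
  - destruct (Pow_x_infinity (x / y)) with (b := d / c + 1) as [N HN].
    { rewrite Rabs_pos_eq by (apply Rle_div_r; lra). apply Rlt_gt, Rlt_div_r; lra. }
    specialize (HN (S N) ltac:(lia)). specialize (H N).
    assert (Hyn : 0 < y ^ S N) by (apply pow_lt; lra).
    rewrite Rabs_pos_eq in HN by (apply pow_le, Rle_div_r; lra).
    unfold Rdiv at 1 in HN. rewrite Rpow_mult_distr, pow_inv in HN.
    assert (x ^ S N * / y ^ S N <= d / c).
    { apply (Rle_div_r _ _ c Hc).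
      replace (x ^ S N * / y ^ S N * c) with ((x ^ S N * c) / y ^ S N) by (field; lra).
      apply Rle_div_l; [lra|]. lra. }
    lra.
  - subst y. specialize (H 0%nat). simpl in H. nra.
Qed.

(* [a] may be a singularity where [h] is merely continuous: apply the maximum
   principle to [h^(n+1) (z - a)] and let [n] tend to infinity. *)
Lemma max_modulus_punctured (h : C -> C) (a : C) (r B : R) :
  0 < r -> Cmod a <= r ->
  (forall z, Cmod z <= r -> continuous h z) ->
  (forall z, Cmod z < r -> z <> a -> ex_derive h z) ->
  (forall z, Cmod z = r -> Cmod (h z) <= B) ->
  forall z, Cmod z <= r -> z <> a -> Cmod (h z) <= B.
Proof.
  intros Hr Ha Hc Hd HB z Hz Hza.
  assert (HB0 : 0 <= B).
  { apply Rle_trans with (Cmod (h (RtoC r))); [apply Cmod_ge_0|].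
    apply HB. rewrite Cmod_R. apply Rabs_pos_eq; lra. }
  apply (pow_ratio_le _ _ (Cmod (z - a)) (2 * r)); [apply Cmod_ge_0|exact HB0| |].
  { apply Cmod_gt_0, Cminus_eq_contra, Hza. }
  intros n. rewrite <- Cmod_pow, <- Cmod_mult.
  apply (max_modulus (fun w => h w ^ S n * (w - a))%C r); [exact Hr| | | |exact Hz].
  - intros w Hw. apply continuous_Cmult.
    + clear -Hc Hw. induction n as [|n IH].
      * apply (continuous_Cmult h (fun _ => RtoC 1)); [apply Hc, Hw|apply continuous_const].
      * apply (continuous_Cmult h (fun w => h w ^ S n)%C); [apply Hc, Hw|exact IH].
    + apply continuous_Cminus; [apply continuous_id|apply continuous_const].
  - intros w Hw Hn0.
    (* The product vanishes at a, so at its nonzero points h is differentiable; this is why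
       [max_modulus] asks for derivatives only where its function is nonzero. *)
    assert (Hwa : w <> a). { intros ->. apply Hn0. ring. }
    apply ex_derive_Cmult; [apply ex_derive_Cpow, Hd; assumption|].
    apply ex_derive_Cminus; [apply ex_derive_Cid|apply ex_derive_Cconst].
  - intros w Hw. rewrite Cmod_mult, Cmod_pow.
    apply Rmult_le_compat; try apply Cmod_ge_0.
    + apply pow_le, Cmod_ge_0.
    + apply pow_incr. split; [apply Cmod_ge_0|apply HB, Hw].
    + pose proof (Cmod_triangle w (- a)) as H. rewrite Cmod_opp in H.
      unfold Cminus. lra.
Qed.

(** The maximum principle for g(z) / z on circles of radius r < R. The quotient is merely continuous
    at 0, whence the punctured version; then r tends to R. *)
Lemma schwarz_lemma (g : C -> C) (R M : R) :
  0 < R -> 0 <= M ->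
  (forall z, Cmod z < R -> ex_derive g z /\ Cmod (g z) <= M) ->
  g (RtoC 0) = RtoC 0 ->
  forall z, Cmod z < R -> Cmod (g z) <= M / R * Cmod z.
Proof.
  intros HR HM Hg H0 z Hz.
  destruct (Ceq_dec z (RtoC 0)) as [->|Nz].
  { rewrite H0, Cmod_0. lra. }
  assert (Hzp : 0 < Cmod z) by (apply Cmod_gt_0, Nz).
  assert (HG0 : ex_derive g (RtoC 0)) by (apply Hg; rewrite Cmod_0; exact HR).
  destruct HG0 as [l Hl].
  set (q := slope g (RtoC 0) l).
  assert (Eq : forall w, g w = (q w * w)%C).
  { intros w. replace (g w) with (g w - g (RtoC 0))%C by (rewrite H0; ring).
    rewrite (slope_spec g (RtoC 0) l w). fold q. ring. }
  assert (key : forall r, Cmod z < r < R -> Cmod (g z) <= M / r * Cmod z).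
  { intros r Hr. rewrite Eq, Cmod_mult. apply Rmult_le_compat_r; [lra|].
    apply (max_modulus_punctured q (RtoC 0) r); try assumption; try lra.
    - rewrite Cmod_0; lra.
    - intros w Hw. destruct (Ceq_dec w (RtoC 0)) as [->|Nw].
      + apply slope_continuous_at, Hl.
      + apply slope_continuous; [apply ex_derive_C_continuous, Hg; lra|exact Nw].
    - intros w Hw Nw. apply slope_ex_derive; [apply Hg; lra|exact Nw].
    - intros w Hw. apply Rle_div_r; [lra|]. rewrite <- Hw, <- Cmod_mult, <- Eq.
      apply Hg; lra. }
  apply Rnot_lt_le. intros Hlt.
  (* By continuity of [r |-> M / r * |z|] the bound also holds at [r = R]. *)
  assert (Hgz : 0 < Cmod (g z)).
  { eapply Rle_lt_trans; [|exact Hlt]. apply Rmult_le_pos; [|lra].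
    apply Rle_div_r; lra. }
  assert (HMz : M * Cmod z < Cmod (g z) * R).
  { replace (M * Cmod z) with (M / R * Cmod z * R) by (field; lra).
    apply Rmult_lt_compat_r; lra. }
  assert (Hb : M * Cmod z / Cmod (g z) < R) by (apply Rlt_div_l; lra).
  set (r := (Rmax (M * Cmod z / Cmod (g z)) (Cmod z) + R) / 2).
  pose proof (Rmax_l (M * Cmod z / Cmod (g z)) (Cmod z)).
  pose proof (Rmax_r (M * Cmod z / Cmod (g z)) (Cmod z)).
  pose proof (Rmax_lub_lt _ _ _ Hb Hz).
  specialize (key r ltac:(unfold r; lra)).
  assert (Hr0 : M * Cmod z / Cmod (g z) < r) by (unfold r; lra).
  apply (Rlt_div_l _ _ _ Hgz) in Hr0.
  assert (Hrp : 0 < r) by (unfold r; lra).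
  replace (M / r * Cmod z) with (M * Cmod z / r) in key by (field; lra).
  apply (Rle_div_r _ _ r Hrp) in key. lra.
Qed.

(** Schwarz's lemma bounds the increments of f at a, and so the derivative. The factor 2 comes from
    |f(a + w) - f(a)| <= 2 M. *)
Lemma cauchy_estimate (f : C -> C) (a : C) (R M : R) :
  0 < R -> (forall z, Cmod (z - a) < R -> ex_derive f z /\ Cmod (f z) <= M) ->
  Cmod (C_derive f a) <= 2 * M / R.
Proof.
  intros HR Hf.
  assert (Ha : Cmod (a - a) < R) by (replace (a - a)%C with (RtoC 0) by ring; rewrite Cmod_0; lra).
  assert (HM : 0 <= M) by (apply Rle_trans with (2 := proj2 (Hf a Ha)), Cmod_ge_0).
  pose proof (C_derive_correct f a (RtoC 0) (proj1 (Hf a Ha))) as HD.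
  assert (HS : forall w, Cmod w < R -> Cmod (f (a + w) - f a)%C <= 2 * M / R * Cmod w).
  { apply (schwarz_lemma (fun w => f (a + w) - f a)%C); [exact HR|lra| |].
    - intros w Hw.
      assert (Hw' : Cmod ((a + w) - a) < R) by (replace (a + w - a)%C with w by ring; exact Hw).
      split.
      + apply ex_derive_Cminus; [|apply ex_derive_Cconst].
        apply (ex_derive_Ccomp f (fun w => a + w)%C); [|apply Hf, Hw'].
        apply ex_derive_Cplus; [apply ex_derive_Cconst|apply ex_derive_Cid].
      + pose proof (Cmod_triangle (f (a + w)%C) (- f a)) as H. rewrite Cmod_opp in H.
        pose proof (proj2 (Hf _ Hw')). pose proof (proj2 (Hf _ Ha)). unfold Cminus. lra.
    - replace (a + RtoC 0)%C with a by ring. ring. }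
  apply le_epsilon. intros eps He.
  destruct (proj1 (is_derive_C_eps _ _ _) HD eps He) as [d [Hd Hw]].
  set (t := Rmin d R / 2).
  assert (Ht : 0 < t /\ t < d /\ t < R).
  { pose proof (Rmin_pos d R Hd HR). pose proof (Rmin_l d R). pose proof (Rmin_r d R).
    unfold t. lra. }
  assert (Et : Cmod (RtoC t) = t) by (rewrite Cmod_R; apply Rabs_pos_eq; lra).
  specialize (Hw (a + RtoC t)%C).
  replace (a + RtoC t - a)%C with (RtoC t) in Hw by ring. rewrite Et in Hw.
  specialize (Hw ltac:(lra)). specialize (HS (RtoC t)). rewrite Et in HS.
  specialize (HS ltac:(lra)).
  pose proof (Cmod_triangle (f (a + RtoC t) - f a)%C
    (- (f (a + RtoC t) - f a - C_derive f a * RtoC t))%C) as H.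
  rewrite Cmod_opp in H.
  replace (f (a + RtoC t) - f a + - (f (a + RtoC t) - f a - C_derive f a * RtoC t))%C
    with (C_derive f a * RtoC t)%C in H by ring.
  rewrite Cmod_mult, Et in H.
  apply Rmult_le_reg_r with t; [lra|]. lra.
Qed.

(** * Injective holomorphic maps have no critical point *)

Lemma is_derive_Cshift (f : C -> C) (b l : C) :
  is_derive f b l -> is_derive (fun w => f (b + w)%C) (RtoC 0) l.
Proof.
  intros H. apply is_derive_C_eps. intros eps He.
  destruct (proj1 (is_derive_C_eps _ _ _) H eps He) as [d [Hd Hw]].
  exists d; split; [exact Hd|]. intros w Hb. specialize (Hw (b + w)%C).
  replace (b + w - b)%C with (w - RtoC 0)%C in Hw by ring.
  replace (b + RtoC 0)%C with b by ring. apply Hw, Hb.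
Qed.

(* Hurwitz' argument: if the derivative at 0 vanishes, then for a suitable
   z0 -> 0 the inverse of the difference quotient of f at z0 is holomorphic,
   bounded on a fixed circle, and unbounded at 0. *)
Lemma injective_derive_neq_0_origin (f : C -> C) (R : R) (l : C) :
  0 < R -> (forall z, Cmod z < R -> ex_derive f z) ->
  (forall z w, Cmod z < R -> Cmod w < R -> f z = f w -> z = w) ->
  is_derive f (RtoC 0) l -> l <> RtoC 0.
Proof.
  intros HR Hd Hinj Hl ->.
  set (r := R / 2). assert (Hr : 0 < r < R) by (unfold r; lra). clearbody r.
  assert (C0 : Cmod (RtoC 0) = 0) by apply Cmod_0.
  assert (Cr : Cmod (RtoC r) = r) by (rewrite Cmod_R; apply Rabs_pos_eq; lra).
  destruct (max_on_closed_bounded (fun z => Cmod z = r)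
    (fun z => - Cmod (f z - f (RtoC 0))) r (RtoC r)) as [k [Hk Hmin]].
  { lra. }
  { intros z Hz; lra. }
  { apply closed_circle. }
  { exact Cr. }
  { intros z Hz. apply (continuous_opp (V := R_NormedModule) (fun z => Cmod (f z - f (RtoC 0)))).
    apply (continuous_Cmod (fun z => f z - f (RtoC 0))%C).
    apply continuous_Cminus; [apply ex_derive_C_continuous, Hd; lra|apply continuous_const]. }
  set (m := Cmod (f k - f (RtoC 0))) in *.
  assert (Hm : 0 < m).
  { apply Cmod_gt_0, Cminus_eq_contra. intros E.
    apply Hinj in E; [|lra|lra]. rewrite E in Hk. lra. }
  set (q0 := slope f (RtoC 0) (RtoC 0)).
  assert (Hq0 : q0 (RtoC 0) = RtoC 0) by apply slope_at.
  (* On |z| = r the quotient centred at z0 will be at least (m / 2) / (2 r) in modulus; at 0 it will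
     be strictly smaller than this same number. *)
  assert (Hmr : 0 < m / (4 * r)) by (apply Rdiv_lt_0_compat; lra).
  destruct (proj1 (continuous_C_eps _ _) (slope_continuous_at _ _ _ Hl) _ Hmr)
    as [d1 [Hd1 H1]].
  assert (Hm2 : 0 < m / 2) by lra.
  destruct (proj1 (continuous_C_eps _ _)
    (ex_derive_C_continuous _ _ (Hd (RtoC 0) ltac:(lra))) _ Hm2) as [d2 [Hd2 H2]].
  set (d := Rmin (Rmin d1 d2) r).
  assert (Hdd : 0 < d /\ d <= d1 /\ d <= d2 /\ d <= r).
  { pose proof (Rmin_pos _ _ Hd1 Hd2) as P12.
    pose proof (Rmin_pos _ _ P12 (proj1 Hr)).
    pose proof (Rmin_l d1 d2). pose proof (Rmin_r d1 d2).
    pose proof (Rmin_l (Rmin d1 d2) r). pose proof (Rmin_r (Rmin d1 d2) r).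
    unfold d. lra. }
  clearbody d.
  (* Otherwise f' vanishes on a disc and f is constant there, against injectivity. A nonzero f'(z0)
     keeps the quotient centred at z0 from vanishing at z0. *)
  assert (Hz0 : exists z0, Cmod z0 < d /\ C_derive f z0 <> RtoC 0).
  { apply NNPP. intros HN.
    set (b := RtoC (d / 2)).
    assert (Hb : Cmod b = d / 2) by (unfold b; rewrite Cmod_R; apply Rabs_pos_eq; lra).
    assert (E : Cmod (f b - f (RtoC 0)) <= 0 * Cmod (b - RtoC 0)).
    { apply Cmod_increment_le. intros t Ht.
      assert (Hbt : Cmod (RtoC 0 + t * (b - RtoC 0)) < d).
      { replace (RtoC 0 + t * (b - RtoC 0))%C with (t * b)%C by ring.
        rewrite Cmod_mult, Hb, Cmod_R, Rabs_pos_eq by lra. nra. }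
      split; [apply Hd; lra|].
      destruct (Ceq_dec (C_derive f (RtoC 0 + t * (b - RtoC 0))%C) (RtoC 0)) as [E|N].
      - rewrite E; lra.
      - exfalso. apply HN. eexists; split; [exact Hbt|exact N]. }
    rewrite Rmult_0_l in E.
    assert (E' : f b = f (RtoC 0)).
    { destruct (Ceq_dec (f b) (f (RtoC 0))) as [E'|N]; [exact E'|].
      apply Cminus_eq_contra, Cmod_gt_0 in N. lra. }
    apply Hinj in E'; [|lra|lra]. rewrite E' in Hb. lra. }
  destruct Hz0 as [z0 [Hz0 N0]].
  assert (Nz0 : z0 <> RtoC 0).
  { intros ->. apply N0. apply is_C_derive_unique, Hl. }
  pose proof (C_derive_correct f z0 (RtoC 0) (Hd z0 ltac:(lra))) as Hz0d.
  set (q := slope f z0 (C_derive f z0)).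
  assert (Hqn : forall z, Cmod z <= r -> q z <> RtoC 0).
  { intros z Hz. unfold q, slope. destruct (Ceq_dec z z0) as [->|Nz]; [exact N0|].
    intros E. assert (E' : (f z - f z0)%C = RtoC 0).
    { replace (f z - f z0)%C with ((f z - f z0) / (z - z0) * (z - z0))%C
        by (field; apply Cminus_eq_contra, Nz).
      rewrite E. ring. }
    apply (Cminus_eq_contra (f z) (f z0)); [|exact E'].
    intros E2. apply Nz. apply Hinj; [lra|lra|exact E2]. }
  assert (Hbound : Cmod (/ q (RtoC 0)) <= 4 * r / m).
  { apply (max_modulus_punctured (fun z => / q z)%C z0 r); try lra.
    - intros z Hz. apply continuous_Cinv; [apply Hqn, Hz|].
      destruct (Ceq_dec z z0) as [->|Nz].
      + apply slope_continuous_at, Hz0d.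
      + apply slope_continuous; [apply ex_derive_C_continuous, Hd; lra|exact Nz].
    - intros z Hz Nz. apply ex_derive_Cinv; [apply Hqn; lra|].
      apply slope_ex_derive; [apply Hd; lra|exact Nz].
    - intros z Hz.
      assert (Nz : z <> z0) by (intros ->; lra).
      rewrite Cmod_inv by (apply Hqn; lra).
      replace (4 * r / m) with (/ (m / (4 * r))) by (field; lra).
      apply Rinv_le_contravar; [exact Hmr|].
      assert (Eq : (f z - f z0 = q z * (z - z0))%C) by apply slope_spec.
      assert (K1 : m / 2 <= Cmod (f z - f z0)).
      { pose proof (Hmin z Hz) as K. cbv beta in K.
        pose proof (Cmod_minus_triangle (f z) (f z0) (f (RtoC 0))).
        specialize (H2 z0). replace (z0 - RtoC 0)%C with z0 in H2 by ring.
        specialize (H2 ltac:(lra)). lra. }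
      assert (K2 : Cmod (z - z0) <= 2 * r).
      { pose proof (Cmod_triangle z (- z0)) as K. rewrite Cmod_opp in K.
        unfold Cminus. lra. }
      rewrite Eq, Cmod_mult in K1.
      apply Rle_div_l; [lra|]. pose proof (Cmod_ge_0 (q z)). nra.
    - intros E. apply Nz0. symmetry. exact E. }
  rewrite Cmod_inv in Hbound by (apply Hqn; lra).
  (* A difference quotient is symmetric in its two points, so q(0) is close to the derivative at 0,
     assumed to be zero. *)
  assert (E0 : q (RtoC 0) = q0 z0).
  { unfold q, q0, slope. destruct (Ceq_dec (RtoC 0) z0) as [E|_]; [congruence|].
    destruct (Ceq_dec z0 (RtoC 0)) as [E|_]; [congruence|].
    field. exact Nz0. }
  assert (Hsmall : Cmod (q (RtoC 0)) < m / (4 * r)).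
  { rewrite E0. specialize (H1 z0).
    replace (z0 - RtoC 0)%C with z0 in H1 by ring. specialize (H1 ltac:(lra)).
    fold q0 in H1. rewrite Hq0 in H1.
    replace (q0 z0 - RtoC 0)%C with (q0 z0) in H1 by ring. exact H1. }
  assert (Hqp : 0 < Cmod (q (RtoC 0))) by (apply Cmod_gt_0, Hqn; lra).
  apply Rinv_lt_contravar in Hsmall; [|apply Rmult_lt_0_compat; assumption].
  replace (/ (m / (4 * r))) with (4 * r / m) in Hsmall by (field; lra). lra.
Qed.

Lemma injective_derive_neq_0 (f : C -> C) (b : C) (R : R) (l : C) :
  0 < R -> (forall z, Cmod (z - b) < R -> ex_derive f z) ->
  (forall z w, Cmod (z - b) < R -> Cmod (w - b) < R -> f z = f w -> z = w) ->
  is_derive f b l -> l <> RtoC 0.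
Proof.
  intros HR Hd Hinj Hl.
  assert (E : forall z, (b + z - b)%C = z) by (intros z; ring).
  apply (injective_derive_neq_0_origin (fun w => f (b + w)%C) R).
  - exact HR.
  - intros z Hz. apply (ex_derive_Ccomp f (fun w => b + w)%C).
    + apply ex_derive_Cplus; [apply ex_derive_Cconst|apply ex_derive_Cid].
    + apply Hd. rewrite E. exact Hz.
  - intros z w Hz Hw Ezw. apply Hinj in Ezw; [|rewrite E; assumption..].
    rewrite <- (E z), Ezw. apply E.
  - apply is_derive_Cshift, Hl.
Qed.

(** In terms of slopes, q(phi(w)) (phi(w) - phi(z)) = s(w) (w - z) near z. As q o phi is continuous
    and nonzero at z, it can be divided out. *)
Lemma holomorphic_inverse_comp (p f phi : C -> C) (z l : C) (r : R) :
  0 < r -> (forall w, Cmod (w - z) < r -> p (phi w) = f w) ->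
  continuous phi z -> is_derive p (phi z) l -> l <> RtoC 0 -> ex_derive f z ->
  ex_derive phi z.
Proof.
  intros Hr E Hc Hp Hl Hf.
  apply is_derive_C_slope in Hp. destruct Hp as [q [Hq [<- Eq]]].
  apply ex_derive_C_slope in Hf. destruct Hf as [s [Hs Es]].
  assert (Hqc : continuous (fun w => q (phi w)) z) by (apply continuous_comp; assumption).
  assert (Hpos : 0 < Cmod (q (phi z))) by (apply Cmod_gt_0, Hl).
  destruct (proj1 (continuous_C_eps _ _) Hqc _ Hpos) as [d [Hd Hw]].
  assert (Hlin : forall w, Cmod (w - z) < Rmin d r ->
    (phi w - phi z = s w / q (phi w) * (w - z))%C).
  { intros w Hwz.
    pose proof (Rmin_l d r). pose proof (Rmin_r d r).
    assert (Hn : q (phi w) <> RtoC 0).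
    { intros E0. specialize (Hw w ltac:(lra)). rewrite E0 in Hw.
      replace (RtoC 0 - q (phi z))%C with (- q (phi z))%C in Hw by ring.
      rewrite Cmod_opp in Hw. lra. }
    replace (s w / q (phi w) * (w - z))%C with ((s w * (w - z)) / q (phi w))%C
      by (field; exact Hn).
    rewrite <- Es, <- (E w) by lra.
    rewrite <- (E z) by (replace (z - z)%C with (RtoC 0) by ring; rewrite Cmod_0; lra).
    rewrite Eq. field. exact Hn. }
  exists (s z / q (phi z))%C. apply is_derive_C_eps. intros eps He.
  assert (Hqs : continuous (fun w => s w / q (phi w))%C z)
    by (apply continuous_Cmult; [exact Hs|apply continuous_Cinv; assumption]).
  destruct (proj1 (continuous_C_eps _ _) Hqs eps He) as [d' [Hd' Hw']].
  assert (Hdr : 0 < Rmin d r) by (apply Rmin_pos; assumption).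
  exists (Rmin d' (Rmin d r)). split; [apply Rmin_pos; assumption|].
  intros w Hwz. pose proof (Rmin_l d' (Rmin d r)). pose proof (Rmin_r d' (Rmin d r)).
  rewrite Hlin by lra. specialize (Hw' w ltac:(lra)).
  replace (s w / q (phi w) * (w - z) - s z / q (phi z) * (w - z))%C
    with ((s w / q (phi w) - s z / q (phi z)) * (w - z))%C by ring.
  rewrite Cmod_mult. apply Rmult_le_compat_r; [apply Cmod_ge_0|lra].
Qed.

(** * Lifting through coverings *)

(** Connectedness of [0, 1]. Near the supremum t0 of the initial segments on which P holds there is
    a point satisfying P, from which P spreads past t0. *)
Lemma interval_induction (P : R -> Prop) :
  P 0 ->
  (forall t, 0 <= t <= 1 -> exists e, 0 < e /\ forall s s',
     0 <= s <= 1 -> 0 <= s' <= 1 -> Rabs (s - t) < e -> Rabs (s' - t) < e -> P s -> P s') ->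
  P 1.
Proof.
  intros H0 Hstep.
  set (T := fun t => 0 <= t <= 1 /\ forall s, 0 <= s <= t -> P s).
  assert (T0 : T 0).
  { split; [lra|]. intros s Hs. replace s with 0 by lra. exact H0. }
  destruct (completeness T) as [t0 [Hub Hlub]].
  { exists 1. intros t [Ht _]. lra. }
  { exists 0. exact T0. }
  assert (Ht0 : 0 <= t0 <= 1).
  { split; [apply Hub, T0|]. apply Hlub. intros t [Ht _]. lra. }
  destruct (Hstep t0 Ht0) as [e [He Hs]].
  assert (Hex : exists s, T s /\ t0 - e < s).
  { apply NNPP. intros HN. assert (t0 <= t0 - e); [|lra].
    apply Hlub. intros t Ht. apply Rnot_lt_le. intros Hlt. apply HN. exists t; auto. }
  destruct Hex as [s [[Hs1 Ps] Hse]].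
  assert (Hst : s <= t0) by (apply Hub; split; assumption).
  assert (Psome : forall s', 0 <= s' <= 1 -> s' < t0 + e -> P s').
  { intros s' Hs' Hlt. destruct (Rle_dec s' s) as [Hle|Hgt]; [apply Ps; lra|].
    apply (Hs s s'); try lra; try (apply Rabs_def1; lra). apply Ps; lra. }
  destruct (Rlt_dec 1 (t0 + e)) as [H1|H1]; [apply Psome; lra|].
  assert (T (t0 + e / 2)).
  { split; [lra|]. intros s' Hs'. apply Psome; lra. }
  pose proof (Hub _ H). lra.
Qed.

Definition convex (N : C -> Prop) : Prop :=
  forall a b (t : R), N a -> N b -> 0 <= t <= 1 -> N (a + t * (b - a))%C.

Lemma Cmod_convex_combination (x y : C) (t r : R) :
  0 <= t <= 1 -> Cmod x < r -> Cmod y < r -> Cmod (x + t * (y - x))%C < r.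
Proof.
  intros Ht Hx Hy.
  replace (x + t * (y - x))%C with (RtoC (1 - t) * x + RtoC t * y)%C
    by (rewrite RtoC_minus; ring).
  eapply Rle_lt_trans; [apply Cmod_triangle|].
  rewrite !Cmod_mult, !Cmod_R, !Rabs_pos_eq by lra.
  destruct (Rle_lt_or_eq_dec 0 t (proj1 Ht)) as [H|<-]; nra.
Qed.

Lemma convex_ball (c : C) (r : R) : convex (fun z => Cmod (z - c) < r).
Proof.
  intros a b t Ha Hb Ht.
  replace (a + t * (b - a) - c)%C with ((a - c) + t * ((b - c) - (a - c)))%C by ring.
  apply Cmod_convex_combination; assumption.
Qed.

Lemma convex_unit_disc : convex unit_disc.
Proof. intros a b t Ha Hb Ht. apply Cmod_convex_combination; assumption. Qed.

Lemma open_unit_disc : open unit_disc.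
Proof.
  apply open_C_eps. intros z Hz. unfold unit_disc in *. exists (1 - Cmod z).
  split; [lra|]. intros w Hw. pose proof (Cmod_triang_inv w z) as H.
  apply Rabs_le_between in H. lra.
Qed.

Definition is_lift (X N : C -> Prop) (p f phi : C -> C) : Prop :=
  forall z, N z -> X (phi z) /\ continuous phi z /\ p (phi z) = f z.

Lemma is_lift_subset (X N N' : C -> Prop) (p f phi : C -> C) :
  (forall z, N' z -> N z) -> is_lift X N p f phi -> is_lift X N' p f phi.
Proof. intros H HL z Hz. apply HL, H, Hz. Qed.

Lemma continuous_open_preimage (f : C -> C) (U : C -> Prop) (z : C) :
  continuous f z -> open U -> U (f z) ->
  exists delta, 0 < delta /\ forall w, Cmod (w - z) < delta -> U (f w).
Proof.
  intros Hf HU Hz. destruct (proj1 (open_C_eps U) HU _ Hz) as [e [He Hw]].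
  destruct (proj1 (continuous_C_eps _ _) Hf e He) as [d [Hd Hwd]].
  exists d; split; [exact Hd|]. intros w Hb. apply Hw, Hwd, Hb.
Qed.

(** Agreement propagates along the segment from a to y. Near any of its points each lift stays in
    one sheet; a single agreement makes the two sheets equal, and p is injective on a sheet. *)
Lemma lift_unique (X Y N : C -> Prop) (p f phi psi : C -> C) (a : C) :
  covering_map X Y p -> convex N -> is_lift X N p f phi -> is_lift X N p f psi ->
  N a -> phi a = psi a -> forall y, N y -> phi y = psi y.
Proof.
  intros [Hp [_ Hcov]] HN Hphi Hpsi Ha Eq y Hy.
  cut (phi (a + 1%R * (y - a))%C = psi (a + 1%R * (y - a))%C).
  { replace (a + 1%R * (y - a))%C with y by ring. trivial. }
  apply (interval_induction (fun t => phi (a + t * (y - a))%C = psi (a + t * (y - a))%C)).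
  { replace (a + 0%R * (y - a))%C with a by ring. exact Eq. }
  intros t Ht. set (c := (a + t * (y - a))%C).
  assert (Hc : N c) by (apply HN; assumption).
  destruct (Hphi c Hc) as [X1 [C1 E1]]. destruct (Hpsi c Hc) as [X2 [C2 E2]].
  destruct (Hcov (p (phi c))) as [U [HU [HUc [_ [I [V [HV [Hdis [HVU Hhom]]]]]]]]].
  { apply Hp, X1. }
  destruct (proj1 (HVU (phi c))) as [i Hi]; [split; assumption|].
  destruct (proj1 (HVU (psi c))) as [j Hj]; [split; [exact X2|rewrite E2, <- E1; exact HUc]|].
  destruct (continuous_open_preimage _ _ _ C1 (HV i) Hi) as [d1 [Hd1 D1]].
  destruct (continuous_open_preimage _ _ _ C2 (HV j) Hj) as [d2 [Hd2 D2]].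
  pose proof (Rmin_pos d1 d2 Hd1 Hd2) as Hd. pose proof (Rmin_l d1 d2). pose proof (Rmin_r d1 d2).
  pose proof (Cmod_ge_0 (y - a)) as Hya.
  exists (Rmin d1 d2 / (Cmod (y - a) + 1)). split; [apply Rdiv_lt_0_compat; lra|].
  assert (Hnear : forall s, Rabs (s - t) < Rmin d1 d2 / (Cmod (y - a) + 1) ->
    Cmod (a + s * (y - a) - c)%C < Rmin d1 d2).
  { intros s Hs. unfold c.
    replace (a + s * (y - a) - (a + t * (y - a)))%C with (RtoC (s - t) * (y - a))%C
      by (rewrite RtoC_minus; ring).
    rewrite Cmod_mult, Cmod_R. apply Rlt_div_r in Hs; [|lra].
    pose proof (Rabs_pos (s - t)). nra. }
  intros s s' Hs Hs' Hst Hst' E.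
  apply Hnear in Hst. apply Hnear in Hst'.
  assert (Eij : i = j).
  { apply (Hdis i j (phi (a + s * (y - a))%C)); [apply D1; lra|].
    rewrite E. apply D2; lra. }
  subst j. destruct (Hhom i) as [sec [Hsec _]].
  assert (HN' : N (a + s' * (y - a))%C) by (apply HN; assumption).
  rewrite <- (proj2 (proj2 (Hsec _ (D1 _ (Rlt_le_trans _ _ _ Hst' (Rmin_l _ _)))))).
  rewrite <- (proj2 (proj2 (Hsec _ (D2 _ (Rlt_le_trans _ _ _ Hst' (Rmin_r _ _)))))).
  f_equal. rewrite (proj2 (proj2 (Hphi _ HN'))), (proj2 (proj2 (Hpsi _ HN'))). reflexivity.
Qed.

(** A neighbourhood of the segment [0, s z0] within D. Tubes of convex sets are convex, so that
    [lift_unique] applies to their intersections with each other and with balls. *)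
Definition tube (D : C -> Prop) (z0 : C) (s eps : R) (z : C) : Prop :=
  D z /\ exists u : R, 0 <= u <= s /\ Cmod (z - u * z0)%C < eps.

Lemma tube_convex (D : C -> Prop) (z0 : C) (s eps : R) : convex D -> convex (tube D z0 s eps).
Proof.
  intros HD a b t [Da [u [Hu Ha]]] [Db [v [Hv Hb]]] Ht.
  split; [apply HD; assumption|]. exists (u + t * (v - u)). split; [nra|].
  replace (a + t * (b - a) - RtoC (u + t * (v - u)) * z0)%C
    with ((a - u * z0) + t * ((b - v * z0) - (a - u * z0)))%C
    by (rewrite RtoC_plus, RtoC_mult, RtoC_minus; ring).
  apply Cmod_convex_combination; assumption.
Qed.

Lemma tube_open (D : C -> Prop) (z0 : C) (s eps : R) (z : C) :
  open D -> tube D z0 s eps z ->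
  exists delta, 0 < delta /\ forall w, Cmod (w - z) < delta -> tube D z0 s eps w.
Proof.
  intros HD [Dz [u [Hu Hz]]]. destruct (proj1 (open_C_eps D) HD z Dz) as [d [Hd Hw]].
  exists (Rmin d (eps - Cmod (z - u * z0)%C)). split; [apply Rmin_pos; lra|].
  intros w Hwz. pose proof (Rmin_l d (eps - Cmod (z - u * z0)%C)).
  pose proof (Rmin_r d (eps - Cmod (z - u * z0)%C)).
  split; [apply Hw; lra|]. exists u. split; [exact Hu|].
  pose proof (Cmod_minus_triangle w z (u * z0)%C). lra.
Qed.

Lemma Cminus_diag (z : C) : (z - z)%C = RtoC 0.
Proof. ring. Qed.

(** Interval induction on the length s of the segment already covered: near t z0 the lift is
    continued by the inverse of p on the sheet that it has reached. *)
Lemma lift_along_segment (X Y D : C -> Prop) (p f : C -> C) (a0 z0 : C) :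
  covering_map X Y p -> open D -> convex D -> D (RtoC 0) -> D z0 ->
  (forall z, D z -> Y (f z) /\ continuous f z) -> X a0 -> p a0 = f (RtoC 0) ->
  exists eps phi, 0 < eps /\ is_lift X (tube D z0 1 eps) p f phi /\ phi (RtoC 0) = a0.
Proof.
  intros Hcm HDo HDc HD0 Hz0 Hf Xa0 Ea0.
  pose proof Hcm as [Hp [_ Hcov]].
  apply (interval_induction (fun s => exists eps phi,
    0 < eps /\ is_lift X (tube D z0 s eps) p f phi /\ phi (RtoC 0) = a0)).
  - destruct (Hcov (f (RtoC 0))) as [U [HU [HUc [_ [I [V [HV [Hdis [HVU Hhom]]]]]]]]];
      [apply Hf, HD0|].
    destruct (proj1 (HVU a0)) as [i Hi]; [split; [exact Xa0|rewrite Ea0; exact HUc]|].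
    destruct (Hhom i) as [sec [Hsec1 Hsec2]].
    destruct (continuous_open_preimage f U (RtoC 0) (proj2 (Hf _ HD0)) HU HUc) as [d [Hd HdU]].
    exists d, (fun z => sec (f z)). split; [exact Hd|]. split.
    + intros z [Dz [u [Hu Hz]]]. replace u with 0 in Hz by lra.
      replace (0%R * z0)%C with (RtoC 0) in Hz by ring.
      destruct (Hsec2 (f z) (HdU z Hz)) as [K1 [K2 K3]]. split; [|split].
      * apply (proj2 (HVU (sec (f z)))). exists i; exact K1.
      * apply continuous_comp; [apply Hf, Dz|exact K2].
      * exact K3.
    + rewrite <- Ea0. apply Hsec1, Hi.
  - intros t Ht. set (c := (t * z0)%C).
    assert (Dc : D c).
    { replace c with (RtoC 0 + t * (z0 - RtoC 0))%C by (unfold c; ring).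
      apply HDc; assumption. }
    destruct (Hcov (f c)) as [U [HU [HUc [_ [I [V [HV [Hdis [HVU Hhom]]]]]]]]];
      [apply Hf, Dc|].
    destruct (continuous_open_preimage f U c (proj2 (Hf _ Dc)) HU HUc) as [d [Hd HdU]].
    pose proof (Cmod_ge_0 z0) as Hz0p.
    exists (d / 2 / (Cmod z0 + 1)). split; [repeat apply Rdiv_lt_0_compat; lra|].
    assert (Hnear : forall u, Rabs (u - t) < d / 2 / (Cmod z0 + 1) -> Cmod (u * z0 - c)%C < d / 2).
    { intros u Hu. unfold c.
      replace (u * z0 - t * z0)%C with (RtoC (u - t) * z0)%C by (rewrite RtoC_minus; ring).
      rewrite Cmod_mult, Cmod_R. apply Rlt_div_r in Hu; [|lra].
      pose proof (Rabs_pos (u - t)). nra. }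
    intros s s' Hs Hs' Hst Hst' [eps [phi [He [Hphi Ephi]]]].
    set (T := tube D z0 s eps) in *.
    assert (Tsz : T (s * z0)%C).
    { split.
      - replace (s * z0)%C with (RtoC 0 + s * (z0 - RtoC 0))%C by ring. apply HDc; assumption.
      - exists s. split; [lra|]. rewrite Cminus_diag, Cmod_0. exact He. }
    assert (HUs : U (f (s * z0)%C)).
    { apply HdU. specialize (Hnear s Hst). lra. }
    destruct (Hphi _ Tsz) as [Xs [_ Es]].
    destruct (proj1 (HVU (phi (s * z0)%C))) as [i Hi].
    { split; [exact Xs|rewrite Es; exact HUs]. }
    destruct (Hhom i) as [sec [Hsec1 Hsec2]].
    assert (Hloc : is_lift X (fun z => D z /\ Cmod (z - c) < d) p f (fun z => sec (f z))).
    { intros z [Dz Hz]. destruct (Hsec2 (f z) (HdU z Hz)) as [K1 [K2 K3]]. split; [|split].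
      - apply (proj2 (HVU (sec (f z)))). exists i; exact K1.
      - apply continuous_comp; [apply Hf, Dz|exact K2].
      - exact K3. }
    (* The tube meets the ball in a convex set containing s z0, where both lifts agree by the choice
       of the sheet. *)
    assert (Hagree : forall w, T w -> Cmod (w - c) < d -> phi w = sec (f w)).
    { intros w Tw Hw.
      apply (lift_unique X Y (fun z => T z /\ Cmod (z - c) < d) p f phi (fun z => sec (f z))
        (s * z0)%C); try assumption.
      - intros x y r [Tx Hx] [Ty Hy] Hr. split.
        + apply tube_convex; assumption.
        + apply convex_ball; assumption.
      - apply (is_lift_subset X T); [|exact Hphi]. intros z [Tz _]; exact Tz.
      - apply (is_lift_subset X _ _ _ _ _) with (2 := Hloc).
        intros z [[Dz _] Hz]; split; assumption.
      - split; [exact Tsz|]. specialize (Hnear s Hst). lra.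
      - rewrite <- Es. symmetry. apply Hsec1, Hi.
      - split; assumption. }
    (* A point of the new tube outside [T] is within d / 2 of some u z0 with s < u <= s'. Since u z0
       is within d / 2 of c, the local section lifts f at that point. *)
    exists (Rmin eps (d / 2)),
      (fun z => if excluded_middle_informative (T z) then phi z else sec (f z)).
    assert (Hd2 : 0 < d / 2) by lra.
    split; [apply Rmin_pos; assumption|]. split.
    + intros z [Dz [u [Hu Hz]]].
      pose proof (Rmin_l eps (d / 2)). pose proof (Rmin_r eps (d / 2)).
      destruct (excluded_middle_informative (T z)) as [Tz|NTz].
      * destruct (Hphi z Tz) as [K1 [K2 K3]]. split; [exact K1|split; [|exact K3]].
        destruct (tube_open D z0 s eps z HDo Tz) as [e [Hep Hw]].
        apply (continuous_ext_locally_C phi _ z e Hep); [|exact K2].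
        intros w Hwz. destruct (excluded_middle_informative (T w)) as [_|NT]; [reflexivity|].
        exfalso. apply NT, Hw, Hwz.
      * assert (Hsu : s < u).
        { apply Rnot_le_lt. intros Hle. apply NTz. split; [exact Dz|].
          exists u. split; [lra|lra]. }
        assert (Hzc : Cmod (z - c) < d).
        { pose proof (Cmod_minus_triangle z (u * z0)%C c).
          apply Rabs_def2 in Hst. apply Rabs_def2 in Hst'.
          assert (Hut : Rabs (u - t) < d / 2 / (Cmod z0 + 1)) by (apply Rabs_def1; lra).
          specialize (Hnear u Hut). lra. }
        destruct (Hloc z (conj Dz Hzc)) as [K1 [K2 K3]]. split; [exact K1|split; [|exact K3]].
        assert (Hdz : 0 < d - Cmod (z - c)) by lra.
        apply (continuous_ext_locally_C (fun w => sec (f w)) _ z _ Hdz); [|exact K2].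
        intros w Hwz. destruct (excluded_middle_informative (T w)) as [Tw|_]; [|reflexivity].
        symmetry. apply Hagree; [exact Tw|].
        pose proof (Cmod_minus_triangle w z c). lra.
    + destruct (excluded_middle_informative (T (RtoC 0))) as [_|NT]; [exact Ephi|].
      exfalso. apply NT. split; [exact HD0|]. exists 0. split; [lra|].
      replace (RtoC 0 - 0%R * z0)%C with (RtoC 0) by ring. rewrite Cmod_0. exact He.
Qed.

(** The value at z is that of a lift on a tube around [0, z]. Two tubes meet in a convex set
    containing 0, where both lifts equal a0, so the values fit together locally. *)
Lemma covering_lift (X Y D : C -> Prop) (p f : C -> C) (a0 : C) :
  covering_map X Y p -> open D -> convex D -> D (RtoC 0) ->
  (forall z, D z -> Y (f z) /\ continuous f z) -> X a0 -> p a0 = f (RtoC 0) ->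
  exists phi, is_lift X D p f phi /\ phi (RtoC 0) = a0.
Proof.
  intros Hcm HDo HDc HD0 Hf Xa0 Ea0.
  destruct (functional_choice (fun z (ep : R * (C -> C)) => D z ->
    0 < fst ep /\ is_lift X (tube D z 1 (fst ep)) p f (snd ep) /\ snd ep (RtoC 0) = a0))
    as [L HL].
  { intros z. destruct (classic (D z)) as [Dz|Nz].
    - destruct (lift_along_segment X Y D p f a0 z Hcm HDo HDc HD0 Dz Hf Xa0 Ea0)
        as [eps [phi [H1 [H2 H3]]]].
      exists (eps, phi). intros _. repeat split; assumption || apply H2; assumption.
    - exists (0, fun w => w). intros Dz. contradiction. }
  exists (fun z => snd (L z) z).
  assert (Hseg : forall z y, D y -> Cmod (y - z) < fst (L z) -> tube D z 1 (fst (L z)) y).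
  { intros z y Dy Hyz. split; [exact Dy|]. exists 1. split; [lra|].
    replace (1%R * z)%C with z by ring. exact Hyz. }
  assert (H0 : forall z, 0 < fst (L z) -> tube D z 1 (fst (L z)) (RtoC 0)).
  { intros z Hz. split; [exact HD0|]. exists 0. split; [lra|].
    replace (RtoC 0 - 0%R * z)%C with (RtoC 0) by ring. rewrite Cmod_0. exact Hz. }
  assert (Hglue : forall z y, D z -> D y -> Cmod (y - z) < fst (L z) ->
    snd (L z) y = snd (L y) y).
  { intros z y Dz Dy Hyz.
    destruct (HL z Dz) as [P1 [L1 E1]]. destruct (HL y Dy) as [P2 [L2 E2]].
    apply (lift_unique X Y (fun w => tube D z 1 (fst (L z)) w /\ tube D y 1 (fst (L y)) w)
      p f (snd (L z)) (snd (L y)) (RtoC 0)); try assumption.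
    - intros a b t [A1 A2] [B1 B2] Ht. split; apply tube_convex; assumption.
    - apply (is_lift_subset _ _ _ _ _ _) with (2 := L1). intros w [Hw _]; exact Hw.
    - apply (is_lift_subset _ _ _ _ _ _) with (2 := L2). intros w [_ Hw]; exact Hw.
    - split; apply H0; assumption.
    - congruence.
    - split; apply Hseg; try assumption. rewrite Cminus_diag, Cmod_0. exact P2. }
  split.
  - intros z Dz. destruct (HL z Dz) as [P1 [L1 E1]].
    assert (Tz : tube D z 1 (fst (L z)) z)
      by (apply Hseg; [exact Dz|rewrite Cminus_diag, Cmod_0; exact P1]).
    destruct (L1 z Tz) as [K1 [K2 K3]]. split; [exact K1|split; [|exact K3]].
    destruct (proj1 (open_C_eps D) HDo z Dz) as [d [Hd Hw]].
    pose proof (Rmin_l d (fst (L z))). pose proof (Rmin_r d (fst (L z))).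
    apply (continuous_ext_locally_C (snd (L z)) _ z _ (Rmin_pos _ _ Hd P1)); [|exact K2].
    intros w Hwz. apply Hglue; [exact Dz|apply Hw; lra|lra].
  - apply HL, HD0.
Qed.

Lemma covering_derive_neq_0 (X Y : C -> Prop) (p : C -> C) (b l : C) :
  covering_map X Y p -> holomorphic_on X p -> X b -> is_derive p b l -> l <> RtoC 0.
Proof.
  intros [Hp [_ Hcov]] Hhol Xb Hl.
  destruct (Hcov (p b)) as [U [HU [HUc [_ [I [V [HV [Hdis [HVU Hhom]]]]]]]]];
    [apply Hp, Xb|].
  destruct (proj1 (HVU b)) as [i Hi]; [split; assumption|].
  destruct (proj1 (open_C_eps _) (HV i) b Hi) as [d [Hd Hw]].
  destruct (Hhom i) as [sec [Hsec _]].
  apply (injective_derive_neq_0 p b d); try assumption.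
  - intros z Hz. apply Hhol. apply (proj2 (HVU z)). exists i. apply Hw, Hz.
  - intros z w Hz Hzw E.
    rewrite <- (proj2 (proj2 (Hsec z (Hw z Hz)))), <- (proj2 (proj2 (Hsec w (Hw w Hzw)))).
    rewrite E. reflexivity.
Qed.

Lemma holomorphic_covering_lift (X Y D : C -> Prop) (p f : C -> C) (a0 : C) :
  covering_map X Y p -> holomorphic_on X p ->
  open D -> convex D -> D (RtoC 0) -> Hol D Y f -> X a0 -> p a0 = f (RtoC 0) ->
  exists phi, Hol D X phi /\ (forall z, D z -> p (phi z) = f z) /\ phi (RtoC 0) = a0.
Proof.
  intros Hcm Hhol HDo HDc HD0 [Hf1 Hf2] Xa0 Ea0.
  destruct (covering_lift X Y D p f a0 Hcm HDo HDc HD0) as [phi [Hphi E]]; try assumption.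
  { intros z Dz. split; [apply Hf2, Dz|apply ex_derive_C_continuous, Hf1, Dz]. }
  exists phi. split; [|split; [|exact E]].
  - split.
    + intros z Dz. destruct (Hphi z Dz) as [K1 [K2 K3]].
      destruct (proj1 (open_C_eps D) HDo z Dz) as [d [Hd Hw]].
      destruct (Hhol _ K1) as [l Hl].
      apply (holomorphic_inverse_comp p f phi z l d Hd).
      * intros w Hwz. apply Hphi, Hw, Hwz.
      * exact K2.
      * exact Hl.
      * apply (covering_derive_neq_0 X Y p (phi z)); assumption.
      * apply Hf1, Dz.
    + intros z Dz. apply Hphi, Dz.
  - intros z Dz. apply Hphi, Dz.
Qed.

(** * Growth of functions and of their derivatives *)

Lemma dyadic_scale (t : R) :
  0 < t <= 1 -> exists n : nat, / 2 ^ (n + 1) < t <= / 2 ^ n.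
Proof.
  intros Ht.
  assert (Hind : forall N : nat, / 2 ^ N < t -> exists n : nat, / 2 ^ (n + 1) < t <= / 2 ^ n).
  { induction N as [|N IH]; intros HN.
    - simpl in HN. lra.
    - destruct (Rlt_dec (/ 2 ^ N) t) as [H|H]; [apply IH, H|].
      exists N. rewrite Nat.add_1_r. lra. }
  destruct (pow_lt_1_zero (/ 2)) with (y := t) as [N HN].
  { rewrite Rabs_pos_eq; lra. }
  { lra. }
  apply (Hind N). specialize (HN N (Nat.le_refl N)).
  rewrite pow_inv, Rabs_pos_eq in HN; [exact HN|].
  left. apply Rinv_0_lt_compat, pow_lt; lra.
Qed.

Lemma inv_pow2_bounds (n : nat) : 0 < / 2 ^ n <= 1.
Proof.
  split; [apply Rinv_0_lt_compat, pow_lt; lra|].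
  rewrite <- Rinv_1. apply Rinv_le_contravar; [lra|]. apply pow_R1_Rle; lra.
Qed.

Lemma unit_disc_RtoC (x : R) : 0 <= x < 1 -> unit_disc (RtoC x).
Proof. intros H. unfold unit_disc. rewrite Cmod_R, Rabs_pos_eq; lra. Qed.

Lemma typical_weight_antitone (v : C -> R) (x y : R) :
  typical_weight v -> 0 <= x <= y -> y < 1 -> v (RtoC y) <= v (RtoC x).
Proof.
  intros [_ [_ [_ [H _]]]] Hxy Hy.
  apply H; try (apply unit_disc_RtoC; lra).
  rewrite !Cmod_R, !Rabs_pos_eq; lra.
Qed.

Lemma Sup_seq_lt_p_infty_bounded (u : nat -> R) :
  Rbar_lt (Sup_seq (fun n => Finite (u n))) p_infty -> exists K, forall n, u n <= K.
Proof.
  intros H.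
  assert (Hle : forall n, Rbar_le (u n) (Sup_seq (fun n => Finite (u n)))).
  { intros n. apply Sup_seq_minor_le with n. apply Rle_refl. }
  destruct (Sup_seq (fun n => Finite (u n))) as [K| |].
  - exists K. exact Hle.
  - contradiction.
  - contradiction (Hle 0%nat).
Qed.

Lemma LimSup_seq_lt_eventually (u : nat -> R) (l : R) :
  Rbar_lt (LimSup_seq u) l -> exists q N, q < l /\ forall n, (N <= n)%nat -> u n <= q.
Proof.
  unfold LimSup_seq. destruct (ex_LimSup_seq u) as [m Hm]; simpl. intros H.
  destruct m as [m| |]; simpl in Hm, H.
  - assert (He : 0 < (l - m) / 2) by lra.
    destruct (Hm (mkposreal _ He)) as [_ [N HN]]. simpl in HN.
    exists (m + (l - m) / 2), N. split; [lra|]. intros n Hn. left. apply HN, Hn.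
  - contradiction.
  - destruct (Hm (l - 1)) as [N HN]. exists (l - 1), N. split; [lra|].
    intros n Hn. left. apply HN, Hn.
Qed.

(** If 2^-(n+1) < t <= 2^-n then t / 2 > 2^-(n+2): two dyadic steps cover the passage from t to t /
    2, whence the square of the dyadic constant. *)
Lemma weight_doubling (v : C -> R) :
  typical_weight v ->
  Rbar_lt
    (Sup_seq (fun n : nat =>
       Finite (v (RtoC (1 - / 2 ^ n)) / v (RtoC (1 - / 2 ^ (n + 1))))))
    p_infty ->
  exists K, 0 < K /\
    forall t, 0 < t <= 1 -> v (RtoC (1 - t)) <= K * v (RtoC (1 - t / 2)).
Proof.
  intros Hv HS. apply Sup_seq_lt_p_infty_bounded in HS. destruct HS as [K HK].
  assert (Hpos : forall n, 0 < v (RtoC (1 - / 2 ^ n))).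
  { intros n. pose proof (inv_pow2_bounds n). apply Hv, unit_disc_RtoC. lra. }
  assert (HKn : forall n, v (RtoC (1 - / 2 ^ n)) <= K * v (RtoC (1 - / 2 ^ (n + 1)))).
  { intros n. apply (Rle_div_l _ _ _ (Hpos (n + 1)%nat)), HK. }
  assert (HKp : 0 < K).
  { specialize (HKn 0%nat). pose proof (Hpos 0%nat). pose proof (Hpos (0 + 1)%nat). nra. }
  exists (K * K). split; [nra|]. intros t Ht.
  destruct (dyadic_scale t Ht) as [n Hn].
  pose proof (inv_pow2_bounds n). pose proof (inv_pow2_bounds (n + 1 + 1)).
  assert (E : / 2 ^ (n + 1 + 1) = / 2 ^ (n + 1) / 2).
  { rewrite (Nat.add_1_r (n + 1)). simpl. field. apply pow_nonzero; lra. }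
  apply Rle_trans with (v (RtoC (1 - / 2 ^ n))).
  { apply typical_weight_antitone; [exact Hv|lra|lra]. }
  apply Rle_trans with (1 := HKn n).
  rewrite Rmult_assoc. apply Rmult_le_compat_l; [lra|].
  apply Rle_trans with (1 := HKn (n + 1)%nat).
  apply Rmult_le_compat_l; [lra|].
  apply typical_weight_antitone; [exact Hv|lra|lra].
Qed.

(** Doubling is iterated N times, where 2^-N < c, and monotonicity does the rest. The constant
    depends on c and K but not on the points. *)
Lemma weight_comparable (v : C -> R) (K c : R) :
  typical_weight v -> 0 < K ->
  (forall t, 0 < t <= 1 -> v (RtoC (1 - t)) <= K * v (RtoC (1 - t / 2))) ->
  0 < c -> exists K', 0 < K' /\
    forall z w, unit_disc z -> unit_disc w -> c * (1 - Cmod z) <= 1 - Cmod w ->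
      v z <= K' * v w.
Proof.
  intros Hv HK Hdbl Hc.
  destruct (pow_lt_1_zero (/ 2)) with (y := c) as [N HN].
  { rewrite Rabs_pos_eq; lra. }
  { exact Hc. }
  specialize (HN N (Nat.le_refl N)). pose proof (inv_pow2_bounds N) as HNp.
  rewrite pow_inv, Rabs_pos_eq in HN by lra.
  exists (K ^ N). split; [apply pow_lt, HK|].
  assert (Hit : forall n t, 0 < t <= 1 ->
    v (RtoC (1 - t)) <= K ^ n * v (RtoC (1 - t * / 2 ^ n))).
  { induction n as [|n IH]; intros t Ht.
    - simpl. rewrite Rinv_1, Rmult_1_r, Rmult_1_l. apply Rle_refl.
    - apply Rle_trans with (1 := IH t Ht). simpl.
      rewrite (Rmult_comm K), Rmult_assoc.
      apply Rmult_le_compat_l; [apply pow_le; lra|].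
      replace (t * / (2 * 2 ^ n)) with (t * / 2 ^ n / 2)
        by (field; apply pow_nonzero; lra).
      apply Hdbl. pose proof (inv_pow2_bounds n). split; nra. }
  intros z w Hz Hw Hzw. unfold unit_disc in Hz, Hw.
  pose proof (Cmod_ge_0 z). pose proof (Cmod_ge_0 w).
  rewrite (proj1 (proj2 Hv) z Hz), (proj1 (proj2 Hv) w Hw).
  replace (Cmod z) with (1 - (1 - Cmod z)) at 1 by ring.
  eapply Rle_trans; [apply (Hit N); lra|].
  apply Rmult_le_compat_l; [apply pow_le; lra|].
  assert ((1 - Cmod z) * / 2 ^ N <= c * (1 - Cmod z)) by nra.
  assert (0 < (1 - Cmod z) * / 2 ^ N) by (apply Rmult_lt_0_compat; lra).
  apply typical_weight_antitone; [exact Hv|lra|lra].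
Qed.

(** The bound L dominates the first N + k terms by linear growth, and L >= B / (1 - q) makes it
    stable under x |-> q x + B. *)
Lemma contracting_recursion_bounded (a : nat -> R) (q M B : R) (k N : nat) :
  0 <= q < 1 -> 0 <= M -> 0 <= B -> 0 <= a 0%nat -> (0 < k)%nat ->
  (forall n, a (S n) <= a n + M) ->
  (forall n, (N <= n)%nat -> a (n + k)%nat <= q * a n + B) ->
  forall n, a n <= a 0%nat + INR (N + k) * M + B / (1 - q).
Proof.
  intros Hq HM HB Ha Hk H1 H2.
  assert (Hlin : forall n, a n <= a 0%nat + INR n * M).
  { induction n as [|n IH]; [simpl; lra|]. rewrite S_INR. specialize (H1 n). lra. }
  assert (HBq : 0 <= B / (1 - q)) by (apply Rle_div_r; lra).
  set (L := a 0%nat + INR (N + k) * M + B / (1 - q)).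
  assert (HL : q * L + B <= L).
  { assert (B = (1 - q) * (B / (1 - q))) by (field; lra).
    assert (0 <= INR (N + k) * M) by (apply Rmult_le_pos; [apply pos_INR|lra]).
    unfold L. nra. }
  intros n. induction n as [n IH] using lt_wf_ind.
  destruct (Nat.lt_ge_cases n (N + k)) as [Hn|Hn].
  - apply Rle_trans with (1 := Hlin n). unfold L.
    assert (INR n * M <= INR (N + k) * M)
      by (apply Rmult_le_compat_r; [lra|apply le_INR; lia]).
    lra.
  - replace n with ((n - k) + k)%nat by lia.
    apply Rle_trans with (1 := H2 (n - k)%nat ltac:(lia)).
    specialize (IH (n - k)%nat ltac:(lia)). fold L in IH.
    apply Rle_trans with (2 := HL). nra.
Qed.

Lemma finite_sup_nonneg_bound (A : C -> Prop) (g : C -> R) :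
  finite_sup A g -> exists M, 0 <= M /\ forall z, A z -> g z <= M.
Proof.
  intros [M HM]. exists (Rmax M 0). split; [apply Rmax_r|].
  intros z Hz. apply Rle_trans with M; [|apply Rmax_l].
  apply HM. exists z; split; [exact Hz|reflexivity].
Qed.

Lemma finite_sup_intro (A : C -> Prop) (g : C -> R) (M : R) :
  (forall z, A z -> g z <= M) -> finite_sup A g.
Proof. intros H. exists M. intros y [z [Hz ->]]. apply H, Hz. Qed.

(** Since (1 - |z|) v(z) is non-increasing in |z|, |f'| <= M / ((1 - s) v(s)) on the segment, whose
    length is at most 1 - s. *)
Lemma radial_increment (v : C -> R) (f : C -> C) (M r s : R) (e : C) :
  typical_weight v -> holomorphic_on unit_disc f -> 0 <= M ->
  (forall z, unit_disc z -> Cmod (C_derive f z) * hat_weight v z <= M) ->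
  Cmod e = 1 -> 0 <= r <= s -> s < 1 -> s - r <= 1 - s ->
  Cmod (f (s * e)%C - f (r * e)%C) * v (RtoC s) <= M.
Proof.
  intros Hv Hf HM Hb He Hrs Hs Hsr.
  assert (Hvs : 0 < v (RtoC s)) by (apply Hv, unit_disc_RtoC; lra).
  assert (Hinc : Cmod (f (s * e)%C - f (r * e)%C)
                 <= M / ((1 - s) * v (RtoC s)) * Cmod (s * e - r * e)).
  { apply Cmod_increment_le. intros t Ht.
    replace (r * e + t * (s * e - r * e))%C with (RtoC (r + t * (s - r)) * e)%C
      by (rewrite RtoC_plus, RtoC_mult, RtoC_minus; ring).
    set (x := r + t * (s - r)). assert (Hx : 0 <= x <= s) by (unfold x; nra).
    assert (Hm : Cmod (RtoC x * e)%C = x)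
      by (rewrite Cmod_mult, He, Cmod_R, Rabs_pos_eq; lra).
    assert (HD : unit_disc (RtoC x * e)%C) by (unfold unit_disc; lra).
    split; [apply Hf, HD|].
    specialize (Hb _ HD). unfold hat_weight in Hb.
    rewrite (proj1 (proj2 Hv) _ HD), Hm in Hb.
    pose proof (typical_weight_antitone v x s Hv ltac:(lra) Hs) as Hvx.
    apply Rle_div_r; [apply Rmult_lt_0_compat; lra|].
    apply Rle_trans with (2 := Hb).
    apply Rmult_le_compat_l; [apply Cmod_ge_0|].
    apply Rmult_le_compat; lra. }
  assert (Hd : Cmod (s * e - r * e) = s - r).
  { replace (s * e - r * e)%C with (RtoC (s - r) * e)%C by (rewrite RtoC_minus; ring).
    rewrite Cmod_mult, He, Cmod_R, Rabs_pos_eq; lra. }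
  rewrite Hd in Hinc.
  apply Rle_div_r; [exact Hvs|]. apply Rle_trans with (1 := Hinc).
  apply Rle_trans with (M / ((1 - s) * v (RtoC s)) * (1 - s)).
  - apply Rmult_le_compat_l; [|lra].
    apply Rle_div_r; [apply Rmult_lt_0_compat; lra|lra].
  - right. field. split; lra.
Qed.

Lemma unimodular_polar (z : C) : exists e, Cmod e = 1 /\ z = (Cmod z * e)%C.
Proof.
  destruct (Ceq_dec z (RtoC 0)) as [->|Hz].
  - exists (RtoC 1). rewrite Cmod_1, Cmod_0. split; [reflexivity|ring].
  - assert (Hm : 0 < Cmod z) by (apply Cmod_gt_0; exact Hz).
    assert (Hc : RtoC (Cmod z) <> RtoC 0) by (intros E; apply RtoC_inj in E; lra).
    exists (z / RtoC (Cmod z))%C. split.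
    + rewrite Cmod_div by exact Hc. rewrite Cmod_R, Rabs_pos_eq by lra. field; lra.
    + field. exact Hc.
Qed.

(* Along a radius, passing from 1 - 2^-n to 1 - 2^-(n+k) increases |f| v by at
   most k M while the decay of v contracts the previous value by a factor q < 1. *)
Lemma Bloch_hat_Hinf (v : C -> R) (f : C -> C) (k : nat) :
  typical_weight v ->
  Rbar_lt
    (LimSup_seq (fun n : nat =>
       v (RtoC (1 - / 2 ^ (n + k))) / v (RtoC (1 - / 2 ^ n))))
    (Finite 1) ->
  Bloch (hat_weight v) f -> Hinf v f.
Proof.
  intros Hv HL [Hf Hb]. split; [exact Hf|].
  apply finite_sup_nonneg_bound in Hb. destruct Hb as [M [HM Hb]].
  apply LimSup_seq_lt_eventually in HL. destruct HL as [q [N [Hq HqN]]].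
  set (V := fun n => v (RtoC (1 - / 2 ^ n))) in *.
  assert (Vpos : forall n, 0 < V n).
  { intros n. pose proof (inv_pow2_bounds n). apply Hv, unit_disc_RtoC. lra. }
  assert (Hhalf : forall n, / 2 ^ S n = / 2 ^ n / 2).
  { intros n. simpl. field. apply pow_nonzero; lra. }
  assert (Vdec : forall n, V (S n) <= V n).
  { intros n. pose proof (inv_pow2_bounds n). pose proof (Hhalf n).
    apply typical_weight_antitone; [exact Hv|lra|lra]. }
  assert (HVq : forall n, (N <= n)%nat -> V (n + k)%nat <= q * V n).
  { intros n Hn. apply (Rle_div_l _ _ _ (Vpos n)), HqN, Hn. }
  assert (Hq0 : 0 <= q).
  { specialize (HVq N (Nat.le_refl N)). pose proof (Vpos N). pose proof (Vpos (N + k)%nat). nra. }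
  (* For k = 0 the ratio is 1, against q < 1. *)
  assert (Hk : (0 < k)%nat).
  { destruct k; [|lia]. specialize (HVq N (Nat.le_refl N)). rewrite Nat.add_0_r in HVq.
    pose proof (Vpos N). nra. }
  assert (V0 : 1 - / 2 ^ 0 = 0) by (simpl; field).
  apply (finite_sup_intro _ _ (Cmod (f (RtoC 0)) * V 0%nat + INR (N + k) * M
    + INR k * M / (1 - q) + M)).
  intros z Hz. destruct (unimodular_polar z) as [e [He Ez]].
  set (a := fun n => Cmod (f ((1 - / 2 ^ n)%R * e)%C) * V n).
  assert (Hstep : forall n, Cmod (f ((1 - / 2 ^ S n)%R * e)%C - f ((1 - / 2 ^ n)%R * e)%C) * V (S n) <= M).
  { intros n. pose proof (inv_pow2_bounds n). pose proof (Hhalf n).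
    apply radial_increment; try assumption; lra. }
  assert (Hmany : forall n j,
    (Cmod (f ((1 - / 2 ^ (n + j))%R * e)%C) - Cmod (f ((1 - / 2 ^ n)%R * e)%C)) * V (n + j)%nat
      <= INR j * M).
  { intros n j. induction j as [|j IH].
    - rewrite Nat.add_0_r. simpl. lra.
    - rewrite Nat.add_succ_r, S_INR. specialize (Hstep (n + j)%nat).
      set (x1 := f ((1 - / 2 ^ S (n + j))%R * e)%C) in *.
      set (x2 := f ((1 - / 2 ^ (n + j))%R * e)%C) in *.
      set (x3 := Cmod (f ((1 - / 2 ^ n)%R * e)%C)) in *.
      pose proof (Cmod_triang_inv x1 x2) as Ht. apply Rabs_le_between in Ht.
      pose proof (Vdec (n + j)%nat). pose proof (Vpos (S (n + j))).
      assert (Hj : 0 <= INR j * M) by (apply Rmult_le_pos; [apply pos_INR|lra]).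
      assert (A1 : (Cmod x2 - x3) * V (S (n + j)) <= INR j * M).
      { destruct (Rle_dec (Cmod x2) x3) as [Hle|Hgt]; [nra|].
        apply Rle_trans with (2 := IH). apply Rmult_le_compat_l; lra. }
      assert (A2 : (Cmod x1 - Cmod x2) * V (S (n + j)) <= M).
      { apply Rle_trans with (2 := Hstep). apply Rmult_le_compat_r; lra. }
      lra. }
  assert (Ha : forall n, a n <= a 0%nat + INR (N + k) * M + INR k * M / (1 - q)).
  { apply contracting_recursion_bounded; try assumption; try lra.
    - apply Rmult_le_pos; [apply pos_INR|exact HM].
    - apply Rmult_le_pos; [apply Cmod_ge_0|left; apply Vpos].
    - intros n. specialize (Hmany n 1%nat). rewrite Nat.add_1_r in Hmany. simpl INR in Hmany.
      pose proof (Vdec n). pose proof (Cmod_ge_0 (f ((1 - / 2 ^ n)%R * e)%C)).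
      unfold a. nra.
    - intros n Hn. specialize (Hmany n k). specialize (HVq n Hn).
      pose proof (Cmod_ge_0 (f ((1 - / 2 ^ n)%R * e)%C)). unfold a. nra. }
  unfold unit_disc in Hz. pose proof (Cmod_ge_0 z) as Hz0.
  destruct (dyadic_scale (1 - Cmod z)) as [n Hn]; [lra|].
  pose proof (inv_pow2_bounds n). rewrite Nat.add_1_r, Hhalf in Hn.
  (* The last, incomplete dyadic step. As 2^-n < 2 (1 - |z|), its length is at most 1 - |z|; it
     accounts for the final [+ M]. *)
  assert (Hinc : Cmod (f (Cmod z * e)%C - f ((1 - / 2 ^ n)%R * e)%C) * v (RtoC (Cmod z)) <= M)
    by (apply radial_increment; try assumption; lra).
  rewrite <- Ez in Hinc. rewrite (proj1 (proj2 Hv) z Hz).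
  specialize (Ha n).
  assert (Ea0 : a 0%nat = Cmod (f (RtoC 0)) * V 0%nat).
  { unfold a. rewrite V0. replace (0%R * e)%C with (RtoC 0) by ring. reflexivity. }
  rewrite Ea0 in Ha.
  pose proof (Cmod_triang_inv (f z) (f ((1 - / 2 ^ n)%R * e)%C)) as Ht.
  apply Rabs_le_between in Ht.
  assert (Hvz : 0 < v (RtoC (Cmod z))) by (apply Hv, unit_disc_RtoC; lra).
  assert (Hvn : v (RtoC (Cmod z)) <= V n) by (apply typical_weight_antitone; [exact Hv|lra|lra]).
  pose proof (Cmod_ge_0 (f ((1 - / 2 ^ n)%R * e)%C)).
  unfold a in Ha.
  assert (Cmod (f z) * v (RtoC (Cmod z)) <=
    (Cmod (f z - f ((1 - / 2 ^ n)%R * e)%C) + Cmod (f ((1 - / 2 ^ n)%R * e)%C)) * v (RtoC (Cmod z)))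
    by (apply Rmult_le_compat_r; lra).
  nra.
Qed.

(** Cauchy's estimate on the disc of radius (1 - |z|) / 2 about z: there 1 - |w| >= (1 - |z|) / 2,
    so v(z) <= K' v(w) and |f| <= M K' / v(z). *)
Lemma Hinf_Bloch_hat (v : C -> R) (f : C -> C) (K : R) :
  typical_weight v -> 0 < K ->
  (forall t, 0 < t <= 1 -> v (RtoC (1 - t)) <= K * v (RtoC (1 - t / 2))) ->
  Hinf v f -> Bloch (hat_weight v) f.
Proof.
  intros Hv HK Hdbl [Hf Hb]. split; [exact Hf|].
  apply finite_sup_nonneg_bound in Hb. destruct Hb as [M [HM Hb]].
  destruct (weight_comparable v K (/ 2) Hv HK Hdbl) as [K' [HK' Hcmp]]; [lra|].
  apply (finite_sup_intro _ _ (4 * M * K')). intros z Hz.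
  pose proof (proj1 Hv z Hz) as Hvz. unfold unit_disc in Hz. pose proof (Cmod_ge_0 z).
  assert (HC : Cmod (C_derive f z) <= 2 * (M * K' / v z) / ((1 - Cmod z) / 2)).
  { apply cauchy_estimate; [lra|]. intros w Hw.
    pose proof (Cmod_triang_inv w z) as Ht. apply Rabs_le_between in Ht.
    assert (Dw : unit_disc w) by (unfold unit_disc; lra).
    split; [apply Hf, Dw|].
    specialize (Hcmp z w Hz Dw ltac:(lra)). specialize (Hb w Dw).
    apply Rle_div_r; [exact Hvz|]. pose proof (Cmod_ge_0 (f w)).
    apply Rle_trans with (Cmod (f w) * (K' * v w)); [apply Rmult_le_compat_l; lra|].
    replace (Cmod (f w) * (K' * v w)) with (Cmod (f w) * v w * K') by ring.
    apply Rmult_le_compat_r; lra. }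
  unfold hat_weight.
  replace (4 * M * K') with (2 * (M * K' / v z) / ((1 - Cmod z) / 2) * ((1 - Cmod z) * v z))
    by (field; lra).
  apply Rmult_le_compat_r; [|exact HC]. apply Rmult_le_pos; lra.
Qed.

(** * Schwarz-Pick and the hyperbolic distance *)

Definition pseudo_dist (z1 z2 : C) : R := Cmod ((z1 - z2) / (1 - z1 * Cconj z2))%C.

Lemma moebius_denominator_neq_0 (a w : C) :
  unit_disc a -> unit_disc w -> (1 - a * Cconj w)%C <> RtoC 0.
Proof.
  unfold unit_disc. intros Ha Hw E.
  assert (E1 : Cmod (a * Cconj w) = 1).
  { replace (a * Cconj w)%C with (RtoC 1 - (1 - a * Cconj w))%C by ring.
    rewrite E. replace (RtoC 1 - RtoC 0)%C with (RtoC 1) by ring. apply Cmod_1. }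
  rewrite Cmod_mult, Cmod_conj in E1.
  pose proof (Cmod_ge_0 a). pose proof (Cmod_ge_0 w). nra.
Qed.

Lemma moebius_identity (a w : C) :
  Cmod (1 - a * Cconj w) * Cmod (1 - a * Cconj w) - Cmod (a - w) * Cmod (a - w) =
  (1 - Cmod a * Cmod a) * (1 - Cmod w * Cmod w).
Proof. rewrite !Cmod_sqr. destruct a, w. unfold Re, Im; simpl. ring. Qed.

Lemma pseudo_dist_mult (a w : C) : unit_disc a -> unit_disc w ->
  pseudo_dist a w * Cmod (1 - a * Cconj w) = Cmod (a - w).
Proof.
  intros Ha Hw. pose proof (moebius_denominator_neq_0 a w Ha Hw) as Hn.
  unfold pseudo_dist. rewrite <- Cmod_mult. f_equal. field. exact Hn.
Qed.

Lemma pseudo_dist_identity (a w : C) : unit_disc a -> unit_disc w ->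
  (1 - pseudo_dist a w * pseudo_dist a w) *
    (Cmod (1 - a * Cconj w) * Cmod (1 - a * Cconj w)) =
  (1 - Cmod a * Cmod a) * (1 - Cmod w * Cmod w).
Proof.
  intros Ha Hw. rewrite <- moebius_identity, <- (pseudo_dist_mult a w Ha Hw). ring.
Qed.

Lemma moebius_denominator_bounds (a w : C) : unit_disc a -> unit_disc w ->
  1 - Cmod a <= Cmod (1 - a * Cconj w) <= 1 + Cmod a.
Proof.
  unfold unit_disc. intros Ha Hw.
  assert (Hm : Cmod (a * Cconj w) <= Cmod a).
  { rewrite Cmod_mult, Cmod_conj. pose proof (Cmod_ge_0 a). nra. }
  pose proof (Cmod_triang_inv (RtoC 1) (a * Cconj w)) as H1.
  pose proof (Cmod_triangle (RtoC 1) (- (a * Cconj w))) as H2.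
  rewrite Cmod_opp in H2. rewrite Cmod_1 in *. apply Rabs_le_between in H1.
  unfold Cminus in *. lra.
Qed.

Lemma pseudo_dist_bounds (a w : C) : unit_disc a -> unit_disc w -> 0 <= pseudo_dist a w < 1.
Proof.
  intros Ha Hw. split; [apply Cmod_ge_0|].
  pose proof (pseudo_dist_identity a w Ha Hw) as E.
  pose proof (moebius_denominator_bounds a w Ha Hw) as Hb.
  unfold unit_disc in *. pose proof (Cmod_ge_0 a). pose proof (Cmod_ge_0 w).
  assert (0 < (1 - Cmod a * Cmod a) * (1 - Cmod w * Cmod w))
    by (apply Rmult_lt_0_compat; nra).
  apply Rnot_le_lt. intros Hle.
  assert (1 <= pseudo_dist a w * pseudo_dist a w) by nra.
  assert (0 <= Cmod (1 - a * Cconj w) * Cmod (1 - a * Cconj w)) by nra.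
  nra.
Qed.

(* A constant of comparison between [1 - |w|] and [1 - pseudo_dist a w]. *)
Definition shift_const (a : C) : R := (1 - Cmod a) / (2 * (1 + Cmod a)).

Lemma shift_const_pos (a : C) : unit_disc a -> 0 < shift_const a.
Proof.
  unfold unit_disc, shift_const. intros Ha. pose proof (Cmod_ge_0 a).
  apply Rdiv_lt_0_compat; lra.
Qed.

(** From [pseudo_dist_identity] with |1 - a conj(w)| <= 1 + |a|; the 2 in [shift_const] comes from 1
    - rho^2 <= 2 (1 - rho). *)
Lemma shift_const_le_pseudo_dist (a w : C) : unit_disc a -> unit_disc w ->
  shift_const a * (1 - Cmod w) <= 1 - pseudo_dist a w.
Proof.
  intros Ha Hw.
  pose proof (pseudo_dist_identity a w Ha Hw) as E.
  pose proof (moebius_denominator_bounds a w Ha Hw) as Hb.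
  pose proof (pseudo_dist_bounds a w Ha Hw) as Hr.
  unfold unit_disc in *. pose proof (Cmod_ge_0 a) as Hap. pose proof (Cmod_ge_0 w) as Hwp.
  set (rho := pseudo_dist a w) in *. set (D := Cmod (1 - a * Cconj w)) in *.
  set (x := Cmod a) in *. set (y := Cmod w) in *.
  unfold shift_const. fold x.
  assert (H1 : (1 - x) * (1 + x) * (1 - y) <= 2 * (1 - rho) * ((1 + x) * (1 + x))).
  { apply Rle_trans with ((1 - x * x) * (1 - y * y)).
    - assert (0 <= (1 - x) * (1 + x) * ((1 - y) * y)) by (repeat apply Rmult_le_pos; lra). nra.
    - rewrite <- E. apply Rmult_le_compat; try nra. }
  assert (H2 : (1 - x) * (1 - y) <= 2 * (1 - rho) * (1 + x)).
  { apply Rmult_le_reg_r with (1 + x); [lra|]. nra. }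
  replace ((1 - x) / (2 * (1 + x)) * (1 - y)) with (((1 - x) * (1 - y)) / (2 * (1 + x)))
    by (field; lra).
  apply Rle_div_l; [lra|]. nra.
Qed.

(** The same identity read the other way, with |1 - a conj(w)| >= 1 - |a|; now 2 comes from 1 -
    |w|^2 <= 2 (1 - |w|). *)
Lemma shift_const_le_of_pseudo_dist (a w : C) (r : R) : unit_disc a -> unit_disc w ->
  r < 1 -> pseudo_dist a w <= r -> shift_const a * (1 - r) <= 1 - Cmod w.
Proof.
  intros Ha Hw Hr1 Hrr.
  pose proof (pseudo_dist_identity a w Ha Hw) as E.
  pose proof (moebius_denominator_bounds a w Ha Hw) as Hb.
  pose proof (pseudo_dist_bounds a w Ha Hw) as Hr.
  unfold unit_disc in *. pose proof (Cmod_ge_0 a) as Hap. pose proof (Cmod_ge_0 w) as Hwp.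
  set (rho := pseudo_dist a w) in *. set (D := Cmod (1 - a * Cconj w)) in *.
  set (x := Cmod a) in *. set (y := Cmod w) in *.
  unfold shift_const. fold x.
  assert (H1 : (1 - r) * ((1 - x) * (1 - x)) <= (1 - x) * (1 + x) * (2 * (1 - y))).
  { apply Rle_trans with ((1 - x * x) * (1 - y * y)).
    - rewrite <- E. apply Rmult_le_compat; try nra.
    - assert (0 <= (1 - x) * (1 + x) * ((1 - y) * (1 - y))) by (repeat apply Rmult_le_pos; lra).
      nra. }
  assert (H2 : (1 - r) * (1 - x) <= 2 * (1 - y) * (1 + x)).
  { apply Rmult_le_reg_r with (1 - x); [lra|]. nra. }
  replace ((1 - x) / (2 * (1 + x)) * (1 - r)) with (((1 - x) * (1 - r)) / (2 * (1 + x)))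
    by (field; lra).
  apply Rle_div_l; [lra|]. nra.
Qed.

Lemma unit_disc_0 : unit_disc (RtoC 0).
Proof. unfold unit_disc. rewrite Cmod_0. lra. Qed.

Lemma Cconj_denominator (a w : C) : Cmod (1 - Cconj a * w) = Cmod (1 - a * Cconj w).
Proof.
  rewrite <- (Cmod_conj (1 - a * Cconj w)). f_equal.
  rewrite Cminus_conj, Cmult_conj, Cconj_conj.
  f_equal. apply injective_projections; simpl; ring.
Qed.

Lemma pseudo_dist_conj (a w : C) : unit_disc a -> unit_disc w ->
  (1 - Cconj a * w)%C <> RtoC 0 /\ Cmod ((w - a) / (1 - Cconj a * w))%C = pseudo_dist a w.
Proof.
  intros Ha Hw. pose proof (moebius_denominator_neq_0 a w Ha Hw) as Hn.
  assert (Hn' : (1 - Cconj a * w)%C <> RtoC 0).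
  { apply Cmod_gt_0. rewrite Cconj_denominator. apply Cmod_gt_0, Hn. }
  split; [exact Hn'|].
  rewrite Cmod_div, Cconj_denominator, Cmod_minus_sym by exact Hn'.
  unfold pseudo_dist. rewrite Cmod_div by exact Hn. reflexivity.
Qed.

(** Composing with the automorphism that sends phi(0) to 0 reduces this to [schwarz_lemma] with both
    constants equal to 1. *)
Lemma schwarz_pick_origin (phi : C -> C) (z : C) :
  Hol unit_disc unit_disc phi -> unit_disc z ->
  pseudo_dist (phi (RtoC 0)) (phi z) <= Cmod z.
Proof.
  intros [Hd Hm] Hz. set (a := phi (RtoC 0)).
  assert (Ha : unit_disc a) by (apply Hm, unit_disc_0).
  rewrite <- (proj2 (pseudo_dist_conj a (phi z) Ha (Hm z Hz))).
  replace (Cmod z) with (1 / 1 * Cmod z) by field.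
  apply (schwarz_lemma (fun w => (phi w - a) / (1 - Cconj a * phi w))%C 1 1); try lra.
  - intros w Hw. pose proof (pseudo_dist_conj a (phi w) Ha (Hm w Hw)) as [Hn Ew].
    split.
    + apply ex_derive_Cdiv; [exact Hn| |].
      * apply ex_derive_Cminus; [apply Hd, Hw|apply ex_derive_Cconst].
      * apply ex_derive_Cminus; [apply ex_derive_Cconst|].
        apply ex_derive_Cmult; [apply ex_derive_Cconst|apply Hd, Hw].
    + rewrite Ew. left. apply pseudo_dist_bounds; [exact Ha|apply Hm, Hw].
  - fold a. unfold Cdiv. ring.
  - exact Hz.
Qed.

Lemma disc_automorphism (a : C) : unit_disc a ->
  exists mu, Hol unit_disc unit_disc mu /\ mu (RtoC 0) = a /\
    forall b, unit_disc b ->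
      exists z, unit_disc z /\ mu z = b /\ Cmod z = pseudo_dist a b.
Proof.
  intros Ha. exists (fun z => (z + a) / (1 + Cconj a * z))%C.
  assert (Hna : unit_disc (- a)%C) by (unfold unit_disc; rewrite Cmod_opp; exact Ha).
  assert (Econj : forall z, (1 - Cconj (- a) * z)%C = (1 + Cconj a * z)%C).
  { intros z. rewrite Copp_conj. ring. }
  assert (Epd : forall z, unit_disc z -> (1 + Cconj a * z)%C <> RtoC 0 /\
    Cmod ((z + a) / (1 + Cconj a * z))%C = pseudo_dist (- a)%C z).
  { intros z Hz. pose proof (pseudo_dist_conj (- a)%C z Hna Hz) as [H1 H2].
    rewrite Econj in H1, H2. split; [exact H1|].
    rewrite <- H2. f_equal. f_equal. ring. }
  split; [split|split].
  - intros z Hz. apply ex_derive_Cdiv; [apply Epd, Hz| |].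
    + apply ex_derive_Cplus; [apply ex_derive_Cid|apply ex_derive_Cconst].
    + apply ex_derive_Cplus; [apply ex_derive_Cconst|].
      apply ex_derive_Cmult; [apply ex_derive_Cconst|apply ex_derive_Cid].
  - intros z Hz. unfold unit_disc. rewrite (proj2 (Epd z Hz)).
    apply pseudo_dist_bounds; assumption.
  - replace (RtoC 0 + a)%C with a by ring.
    replace (1 + Cconj a * RtoC 0)%C with (RtoC 1) by ring. field.
  - intros b Hb. pose proof (pseudo_dist_conj a b Ha Hb) as [Hn Eb].
    set (z := ((b - a) / (1 - Cconj a * b))%C) in *.
    assert (Hz : unit_disc z).
    { unfold unit_disc. rewrite Eb. apply pseudo_dist_bounds; assumption. }
    exists z. split; [exact Hz|split; [|exact Eb]].
    destruct (Epd z Hz) as [Hnz _].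
    apply (Ceq_minus _ _).
    assert (E : (z + a = b * (1 + Cconj a * z))%C) by (unfold z; field; exact Hn).
    rewrite E. field. exact Hnz.
Qed.

(* Writing g = p o phi with phi a self-map of the disc, Schwarz-Pick shows that
   phi(z) is not much closer to the circle than z. *)
Lemma subordinate_growth (v : C -> R) (Omega : C -> Prop) (p : C -> C) (a : C) (K M : R) :
  holomorphic_universal_covering Omega p -> unit_disc a -> 0 <= K ->
  (forall z w, unit_disc z -> unit_disc w -> shift_const a * (1 - Cmod z) <= 1 - Cmod w ->
     v z <= K * v w) ->
  (forall z, unit_disc z -> Cmod (p z) * v z <= M) ->
  forall g, Hol unit_disc Omega g -> g (RtoC 0) = p a ->
  forall z, unit_disc z -> Cmod (g z) * v z <= K * M.
Proof.
  intros [[Hp _] Hcov] Ha HK Hcmp HM g Hg Eg z Hz.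
  destruct (holomorphic_covering_lift unit_disc Omega unit_disc p g a Hcov Hp)
    as [phi [Hphi [Ephi Ephi0]]]; try assumption.
  { exact open_unit_disc. }
  { exact convex_unit_disc. }
  { exact unit_disc_0. }
  { symmetry; exact Eg. }
  pose proof (schwarz_pick_origin phi z Hphi Hz) as HSP. rewrite Ephi0 in HSP.
  assert (Hpz : unit_disc (phi z)) by (apply Hphi, Hz).
  pose proof (shift_const_le_of_pseudo_dist a (phi z) (Cmod z) Ha Hpz Hz HSP) as Hc.
  specialize (Hcmp z (phi z) Hz Hpz Hc). specialize (HM (phi z) Hpz).
  rewrite Ephi in HM by exact Hz.
  pose proof (Cmod_ge_0 (g z)).
  apply Rle_trans with (Cmod (g z) * (K * v (phi z))); [apply Rmult_le_compat_l; lra|].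
  replace (Cmod (g z) * (K * v (phi z))) with (K * (Cmod (g z) * v (phi z))) by ring.
  apply Rmult_le_compat_l; lra.
Qed.

(** This is tanh (d / 2), the inverse of rho |-> log ((1 + rho) / (1 - rho)); it turns [disc_dist]
    back into [pseudo_dist]. *)
Definition tanh_half (d : R) : R := (exp d - 1) / (exp d + 1).

Lemma tanh_half_disc_dist (a b : C) : unit_disc a -> unit_disc b ->
  tanh_half (disc_dist a b) = pseudo_dist a b.
Proof.
  intros Ha Hb. pose proof (pseudo_dist_bounds a b Ha Hb) as Hr.
  unfold tanh_half, disc_dist. fold (pseudo_dist a b).
  rewrite exp_ln by (apply Rdiv_lt_0_compat; lra). field. split; lra.
Qed.

Lemma disc_dist_nonneg (a b : C) : unit_disc a -> unit_disc b -> 0 <= disc_dist a b.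
Proof.
  intros Ha Hb. pose proof (pseudo_dist_bounds a b Ha Hb) as Hr.
  unfold disc_dist. fold (pseudo_dist a b). rewrite <- ln_1.
  apply ln_le; [lra|]. apply Rle_div_r; lra.
Qed.

Lemma tanh_half_le (x y : R) : x <= y -> tanh_half x <= tanh_half y.
Proof.
  intros H. unfold tanh_half. pose proof (exp_pos x). pose proof (exp_pos y).
  assert (exp x <= exp y) by (destruct H as [H| ->]; [left; apply exp_increasing, H|lra]).
  apply Rle_div_l; [lra|].
  replace ((exp y - 1) / (exp y + 1) * (exp x + 1))
    with (((exp y - 1) * (exp x + 1)) / (exp y + 1)) by (field; lra).
  apply Rle_div_r; [lra|]. nra.
Qed.

Lemma tanh_half_bounds (x : R) : 0 <= x -> 0 <= tanh_half x < 1.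
Proof.
  intros H. unfold tanh_half. pose proof (exp_pos x).
  assert (1 <= exp x)
    by (rewrite <- exp_0; destruct H as [H| <-]; [left; apply exp_increasing, H|lra]).
  split; [apply Rle_div_r; lra|apply Rlt_div_l; lra].
Qed.

(** The pair (a0, b0) keeps the infimum below [p_infty], and distances are non-negative, so [real]
    extracts a true value and not its default. *)
Lemma hyp_dist_glb (p : C -> C) (w1 w2 : C) (a0 b0 : C) :
  unit_disc a0 -> unit_disc b0 -> p a0 = w1 -> p b0 = w2 ->
  0 <= hyp_dist p w1 w2 /\
  (forall a b, unit_disc a -> unit_disc b -> p a = w1 -> p b = w2 ->
     hyp_dist p w1 w2 <= disc_dist a b) /\
  (forall eps, 0 < eps -> exists a b, unit_disc a /\ unit_disc b /\ p a = w1 /\ p b = w2 /\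
     disc_dist a b < hyp_dist p w1 w2 + eps).
Proof.
  intros Ha0 Hb0 Ea0 Eb0. unfold hyp_dist.
  set (E := fun d : R => exists a b : C,
    unit_disc a /\ unit_disc b /\ p a = w1 /\ p b = w2 /\ d = disc_dist a b).
  destruct (Glb_Rbar_correct E) as [Hlb Hgl].
  assert (H0 : Rbar_le 0 (Glb_Rbar E)).
  { apply Hgl. intros d [a [b [Ha [Hb [_ [_ ->]]]]]]. apply disc_dist_nonneg; assumption. }
  assert (H1 : Rbar_le (Glb_Rbar E) (disc_dist a0 b0)).
  { apply Hlb. exists a0, b0. repeat split; assumption. }
  destruct (Glb_Rbar E) as [d| |]; simpl in H0, H1; try contradiction. simpl.
  split; [exact H0|split].
  - intros a b Ha Hb Ea Eb. apply (Hlb (disc_dist a b)). exists a, b. repeat split; assumption.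
  - intros eps He. apply NNPP. intros HN.
    assert (HB : Rbar_le (d + eps) d).
    { apply (Hgl (d + eps)). intros d' [a [b [Ha [Hb [Ea [Eb ->]]]]]].
      apply Rnot_lt_le. intros Hlt. apply HN. exists a, b. repeat split; assumption. }
    simpl in HB. lra.
Qed.

Lemma continuous_tanh_half (d : R) : continuous tanh_half d.
Proof.
  apply (ex_derive_continuous (V := R_NormedModule)). unfold tanh_half. auto_derive.
  pose proof (exp_pos d). lra.
Qed.

(** Passes a bound from nearly minimal distances e to their infimum d. Monotonicity alone would go
    the wrong way, since the weight is larger at d; continuity of [v] is what makes it work. *)
Lemma weight_le_at_inf (v : C -> R) (x L d : R) :
  typical_weight v -> 0 <= d ->
  (forall eps, 0 < eps -> exists e, d <= e < d + eps /\ x * v (RtoC (tanh_half e)) <= L) ->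
  x * v (RtoC (tanh_half d)) <= L.
Proof.
  intros Hv Hd H. apply Rnot_lt_le. intros Hlt.
  assert (Hc : continuous (fun t => x * v (RtoC (tanh_half t))) d).
  { apply (continuous_scal_r (V := R_NormedModule) x (fun t => v (RtoC (tanh_half t)))).
    apply (continuous_comp (fun t => RtoC (tanh_half t)) v).
    - apply (continuous_comp_2 (V := R_UniformSpace) (W := R_UniformSpace) (X := C_UniformSpace)
        tanh_half (fun _ => 0) (fun a b => (a, b) : C)).
      + apply continuous_tanh_half.
      + apply continuous_const.
      + apply (continuous_ext (fun w : R * R => w)); [intros [? ?]; reflexivity|].
        apply continuous_id.
    - apply Hv, unit_disc_RtoC, tanh_half_bounds, Hd. }
  assert (Hpos : 0 < x * v (RtoC (tanh_half d)) - L) by lra.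
  destruct (proj1 (filterlim_locally _ _) Hc (mkposreal _ Hpos)) as [del Hdel].
  destruct (H del (cond_pos del)) as [e [He HeL]].
  assert (Hb : ball d del e).
  { change (Rabs (e - d) < del). apply Rabs_def1; pose proof (cond_pos del); lra. }
  specialize (Hdel e Hb).
  change (Rabs (x * v (RtoC (tanh_half e)) - x * v (RtoC (tanh_half d)))
    < x * v (RtoC (tanh_half d)) - L) in Hdel.
  apply Rabs_def2 in Hdel. lra.
Qed.

Theorem proposition8p3 :
  forall (v : C -> R) (Omega : C -> Prop) (f_Omega : C -> C),
    typical_weight v ->
    essential_weight v ->
    (exists k : nat,
       Rbar_lt
         (LimSup_seq (fun n : nat =>
            v (RtoC (1 - / 2 ^ (n + k))) / v (RtoC (1 - / 2 ^ n))))
         (Finite 1) /\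
       Rbar_lt
         (Sup_seq (fun n : nat =>
            Finite (v (RtoC (1 - / 2 ^ n)) / v (RtoC (1 - / 2 ^ (n + 1))))))
         p_infty) ->
    hyperbolic_domain Omega ->
    holomorphic_universal_covering Omega f_Omega ->
    Omega (RtoC 0) ->
    ((forall f : C -> C, Hol unit_disc Omega f -> Bloch (hat_weight v) f) <->
     Bloch (hat_weight v) f_Omega) /\
    (Bloch (hat_weight v) f_Omega <->
     finite_sup Omega (fun w : C =>
       Cmod w *
       v (RtoC ((exp (hyp_dist f_Omega (RtoC 0) w) - 1) /
                (exp (hyp_dist f_Omega (RtoC 0) w) + 1))))).
Proof.
  intros v Omega p Hv _ [k [Hlim Hsup]] _ Hp HO0.
  destruct (weight_doubling v Hv Hsup) as [K [HK Hdbl]].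
  assert (Hgrow : Bloch (hat_weight v) p -> exists M, 0 <= M /\
            forall z, unit_disc z -> Cmod (p z) * v z <= M).
  { intros HB. apply finite_sup_nonneg_bound. apply (Bloch_hat_Hinf v p k Hv Hlim HB). }
  pose proof (proj1 (proj2 (proj2 Hp))) as Hsurj.
  split; split.
  - intros H. apply H, Hp.
  - intros HB f Hf. destruct (Hgrow HB) as [M [HM HMp]].
    apply (Hinf_Bloch_hat v f K Hv HK Hdbl). split; [apply Hf|].
    (* The constant may depend on this preimage, as a single f is being bounded. *)
    destruct (Hsurj (f (RtoC 0))) as [a [Ha Ea]]; [apply Hf, unit_disc_0|].
    destruct (weight_comparable v K (shift_const a) Hv HK Hdbl (shift_const_pos a Ha))
      as [K' [HK' Hcmp]].
    apply (finite_sup_intro _ _ (K' * M)).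
    apply (subordinate_growth v Omega p a); try assumption; [lra|symmetry; exact Ea].
  - intros HB. destruct (Hgrow HB) as [M [HM HMp]].
    (* [a0] is fixed before w, so that one [K'] serves every w and every nearly minimal pair. *)
    destruct (Hsurj _ HO0) as [a0 [Ha0 Ea0]].
    destruct (weight_comparable v K (shift_const a0) Hv HK Hdbl (shift_const_pos a0 Ha0))
      as [K' [HK' Hcmp]].
    apply (finite_sup_intro _ _ (K' * M)). intros w Hw.
    destruct (Hsurj w Hw) as [b0 [Hb0 Eb0]].
    destruct (hyp_dist_glb p (RtoC 0) w a0 b0 Ha0 Hb0 Ea0 Eb0) as [Hd0 [Hdle Hdlt]].
    apply (weight_le_at_inf v (Cmod w) (K' * M) _ Hv Hd0).
    intros eps He. destruct (Hdlt eps He) as [a [b [Ha [Hb [Ea [Eb Hlt]]]]]].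
    exists (disc_dist a b). split; [split; [apply Hdle; assumption|exact Hlt]|].
    rewrite tanh_half_disc_dist by assumption.
    (* Recentring the pair at the origin: p o mu sends 0 to p(a) = 0 = p(a0), and the point z with
       mu(z) = b has modulus [pseudo_dist a b]. The claim becomes a growth bound for p o mu at z. *)
    destruct (disc_automorphism a Ha) as [mu [Hmu [Emu0 Hmub]]].
    destruct (Hmub b Hb) as [z [Hz [Ez Hzr]]].
    rewrite <- Hzr, <- (proj1 (proj2 Hv) z Hz), <- Eb, <- Ez.
    apply (subordinate_growth v Omega p a0 K' M Hp Ha0 ltac:(lra) Hcmp HMp (fun z => p (mu z)));
      [split| |exact Hz].
    + intros x Hx. apply (ex_derive_Ccomp p mu); [apply Hmu, Hx|apply Hp, Hmu, Hx].
    + intros x Hx. apply Hp, Hmu, Hx.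
    + rewrite Emu0, Ea, Ea0. reflexivity.
  - intros HC. apply finite_sup_nonneg_bound in HC. destruct HC as [M [HM HC]].
    apply (Hinf_Bloch_hat v p K Hv HK Hdbl). split; [apply Hp|].
    destruct (Hsurj _ HO0) as [a [Ha Ea]].
    destruct (weight_comparable v K (shift_const a) Hv HK Hdbl (shift_const_pos a Ha))
      as [K' [HK' Hcmp]].
    apply (finite_sup_intro _ _ (K' * M)). intros z Hz.
    assert (HOz : Omega (p z)) by (apply Hp, Hz).
    destruct (hyp_dist_glb p (RtoC 0) (p z) a z Ha Hz Ea eq_refl) as [Hd0 [Hdle _]].
    specialize (HC (p z) HOz). cbv beta in HC.
    fold (tanh_half (hyp_dist p (RtoC 0) (p z))) in HC.
    (* The pair (a, z) competes in the infimum, so x <= [pseudo_dist a z]. Hence 1 - x is at least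
       [shift_const a] times 1 - |z|, as the comparison of weights requires. *)
    pose proof (tanh_half_le _ _ (Hdle a z Ha Hz Ea eq_refl)) as Hle.
    rewrite tanh_half_disc_dist in Hle by assumption.
    set (x := tanh_half (hyp_dist p (RtoC 0) (p z))) in *.
    pose proof (tanh_half_bounds _ Hd0) as Hx. fold x in Hx.
    assert (Hcx : Cmod (RtoC x) = x) by (rewrite Cmod_R; apply Rabs_pos_eq; lra).
    assert (Hvz : v z <= K' * v (RtoC x)).
    { apply Hcmp; [exact Hz|apply unit_disc_RtoC; lra|].
      pose proof (shift_const_le_pseudo_dist a z Ha Hz). rewrite Hcx. lra. }
    pose proof (Cmod_ge_0 (p z)).
    apply Rle_trans with (Cmod (p z) * (K' * v (RtoC x))); [apply Rmult_le_compat_l; lra|].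
    replace (Cmod (p z) * (K' * v (RtoC x))) with (K' * (Cmod (p z) * v (RtoC x))) by ring.
    apply Rmult_le_compat_l; lra.
Qed.
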